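(* Let $m\in\mathbb{N}\cup\{0\}$, $0<\alpha<n$, $0<\eta\le 1$, and let $T_\alpha$ be a fractional operator whose convolution kernel $K_\alpha$ satisfies the size condition $S_\alpha$ and the smoothness condition $H^*_{\alpha,\infty}$ with exponent $\eta$. Let $0<\delta<\min\{\eta,(n-\alpha)/m\}$. Let $n/(m\delta+\alpha)\le r<n/(\alpha+(m-1)\delta)$ if $m\ge1$, or $n/\alpha\le r<n/(\alpha-\eta)^+$ if $m=0$. Let $\widetilde\delta=m\delta+\alpha-\frac nr$ and $b\in\Lambda(\delta)$. If $w\in A_{r,\infty}$, then there exists a positive constant $C$ such that $$\|T^m_{\alpha,b}f\|_{\mathbb{L}_w(\widetilde\delta)}\le C\,\|b\|_{\Lambda(\delta)}^m\,\|fw\|_{L^r}$$ for every $f\in L^r_w(\mathbb{R}^n)$.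
   Context: Operators: $T_\alpha f(x)=\int_{\mathbb{R}^n}K_\alpha(x-y)f(y)\,dy$, where $K_\alpha$ is not identically zero. For a symbol $b\in L^1_{\rm loc}(\mathbb{R}^n)$ the commutator of order $m$ is formally defined by $T^m_{\alpha,b}f(x)=\int_{\mathbb{R}^n}(b(x)-b(y))^mK_\alpha(x-y)f(y)\,dy$; thus $T^0_{\alpha,b}=T_\alpha$. Condition $S_\alpha$: there is $C>0$ with $\int_{s<|x|\le 2s}|K_\alpha(x)|\,dx\le Cs^\alpha$ for every $s>0$. Condition $H^*_{\alpha,\infty}$ (with exponent $0<\eta\le1$): there is $C>0$ such that $|K_\alpha(x-y)-K_\alpha(x'-y)|+|K_\alpha(y-x)-K_\alpha(y-x')|\le C\frac{|x-x'|^\eta}{|x-y|^{n-\alpha+\eta}}$ whenever $|x-y|\ge 2|x-x'|$. Symbols: for $0<\delta<1$, $\Lambda(\delta)$ is the set of functions $b$ for which there is $C>0$ with $|b(x)-b(y)|\le C|x-y|^\delta$ for all $x,y\in\mathbb{R}^n$; $\|b\|_{\Lambda(\delta)}$ is the smallest such $C$. Weights: a weight is a non-negative locally integrable function $w$. $f\in L^r_w(\mathbb{R}^n)$ means $fw\in L^r(\mathbb{R}^n)$. $w\in A_{r,\infty}$ means $w^{-r'}\in A_1$ (Muckenhoupt's class), where $1/r+1/r'=1$. Weighted Lipschitz spaces: for $0\le\sigma<1$ and a weight $w$, $\mathbb{L}_w(\sigma)$ is the set of $f\in L^1_{\rm loc}(\mathbb{R}^n)$ with $\|f\|_{\mathbb{L}_w(\sigma)}:=\sup_B\frac{\|w\chi_B\|_\infty}{|B|^{1+\sigma/n}}\int_B|f(x)-f_B|\,dx<\infty$,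 where the supremum is over all balls $B$, $f_B=\frac1{|B|}\int_Bf$, and $\|\cdot\|_\infty$ is the essential supremum ($\sigma=0$ is a weighted $BMO$ space). Conventions: $\beta^+=\beta$ if $\beta>0$ and $\beta^+=0$ if $\beta\le0$; $\beta/0=\infty$ if $\beta>0$; when $m=0$ no symbol $b$ and no parameter $\delta$ are involved. *)

(* Defs.v *)
From HB Require Import structures.
From mathcomp Require Import all_boot all_order all_algebra.
From mathcomp Require Import all_classical all_reals all_analysis measurable_realfun.

Set Implicit Arguments.
Unset Strict Implicit.
Unset Printing Implicit Defensive.

Import Order.TTheory GRing.Theory Num.Theory.
Import numFieldNormedType.Exports.

Local Open Scope classical_set_scope.
Local Open Scope ring_scope.

Definition rV_display : measure_display.
Proof. exact: default_measure_display. Qed.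

Section measurable_rV.
Context {R : realType} {n : nat}.

Let coord (i : 'I_n) (x : 'rV[R]_n) : measurableTypeR R := x ord0 i.

Let rV_set0 : g_sigma_preimage coord set0.
Proof. exact: sigma_algebra0. Qed.

Let rV_setC A : g_sigma_preimage coord A -> g_sigma_preimage coord (~` A).
Proof. exact: sigma_algebraC. Qed.

Let rV_bigcup (F : (set 'rV[R]_n)^nat) :
  (forall i, g_sigma_preimage coord (F i)) ->
  g_sigma_preimage coord (\bigcup_i (F i)).
Proof. exact: sigma_algebra_bigcup. Qed.

(* Generated by the coordinates, i.e. the Borel sigma-algebra of R^n. *)
HB.instance Definition _ := @isMeasurable.Build rV_display 'rV[R]_n
  (g_sigma_preimage coord) rV_set0 rV_setC rV_bigcup.

Lemma measurable_coord (i : 'I_n) :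
  measurable_fun [set: 'rV[R]_n] (fun x => x ord0 i : measurableTypeR R).
Proof.
move=> _ Y mY; rewrite setTI; apply: sub_sigma_algebra => /=.
rewrite -bigcup_seq/=; exists i => /=; first by rewrite mem_index_enum.
by exists Y => //; rewrite setTI.
Qed.

Lemma measurable_fun_rV d (T : measurableType d) (f : T -> 'rV[R]_n) :
  (forall i, measurable_fun [set: T] (fun t => f t ord0 i : measurableTypeR R)) ->
  measurable_fun [set: T] f.
Proof.
move=> mf.
pose G := \big[setU/set0]_(i < n) preimage_set_system setT (coord i) measurable.
apply: (@measurability _ _ _ _ setT f G) => //.
move=> _ [A GA <-]; move: GA; rewrite /G -bigcup_seq => -[i _ [B mB <-]].
by rewrite !setTI -comp_preimage -[X in measurable X]setTI; exact: mf.
Qed.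

End measurable_rV.

(* The library's canonical [SigmaFiniteMeasure] instance on [\x] only fires for
   products of subprobabilities. *)
Lemma sigma_finite_product d1 d2 (T1 : measurableType d1)
    (T2 : measurableType d2) (R : realType)
    (m1 : {sigma_finite_measure set T1 -> \bar R})
    (m2 : {sigma_finite_measure set T2 -> \bar R}) :
  sigma_finite setT (m1 \x m2)%E.
Proof.
have /sigma_finiteP[F [TF ndF Foo]] := sigma_finiteT m1.
have /sigma_finiteP[G [TG ndG Goo]] := sigma_finiteT m2.
exists (fun n => F n `*` G n).
  rewrite -setXTT TF TG predeqE => -[x y]; split.
    move=> [/= [n _ Fnx] [k _ Gky]]; exists (maxn n k) => //; split.
    - by move: x Fnx; exact/subsetPset/ndF/leq_maxl.
    - by move: y Gky; exact/subsetPset/ndG/leq_maxr.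
  by move=> [n _ []/= ? ?]; split; exists n.
move=> k; have [? ?] := Foo k; have [? ?] := Goo k.
split; first exact: measurableX.
by rewrite product_measure1E// lte_mul_pinfty// ge0_fin_numE.
Qed.

Section lebesgue_step.
Context {R : realType} {n : nat}.
Variable mu : {sigma_finite_measure set 'rV[R]_n -> \bar R}.

Definition rV_cons (p : measurableTypeR R * 'rV[R]_n) : 'rV[R]_n.+1 :=
  \row_(i < n.+1) if unlift ord0 i is Some j then p.2 ord0 j else p.1.

Lemma rV_cons0 p : rV_cons p ord0 ord0 = p.1.
Proof. by rewrite mxE unlift_none. Qed.

Lemma rV_consS p (i : 'I_n) : rV_cons p ord0 (lift ord0 i) = p.2 ord0 i.
Proof. by rewrite mxE liftK. Qed.

Definition rV_uncons (x : 'rV[R]_n.+1) : measurableTypeR R * 'rV[R]_n :=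
  (x ord0 ord0, \row_(i < n) x ord0 (lift ord0 i)).

Lemma rV_consK : cancel rV_cons rV_uncons.
Proof.
move=> [a x]; rewrite /rV_uncons rV_cons0; congr pair.
by apply/rowP => i; rewrite mxE rV_consS.
Qed.

Lemma measurable_rV_cons : measurable_fun [set: measurableTypeR R * 'rV[R]_n] rV_cons.
Proof.
apply: measurable_fun_rV => i; case: (unliftP ord0 i) => [j ->|->].
  under eq_fun do rewrite rV_consS.
  exact: measurableT_comp (measurable_coord j) measurable_snd.
under eq_fun do rewrite rV_cons0.
exact: measurable_fst.
Qed.

Lemma measurable_rV_uncons : measurable_fun [set: 'rV[R]_n.+1] rV_uncons.
Proof.
apply: measurable_fun_pair; first exact: measurable_coord.
apply: measurable_fun_rV => i; under eq_fun do rewrite mxE.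
exact: measurable_coord.
Qed.

Definition lebesgue_step : set 'rV[R]_n.+1 -> \bar R :=
  pushforward (lebesgue_measure \x mu)%E rV_cons.

Let lebesgue_step0 : lebesgue_step set0 = 0%E.
Proof. by rewrite /lebesgue_step /pushforward preimage_set0 measure0. Qed.

Let lebesgue_step_ge0 A : (0 <= lebesgue_step A)%E.
Proof. exact: (@measure_ge0 _ _ _ (lebesgue_measure \x mu)%E). Qed.

Let lebesgue_step_sigma_additive : semi_sigma_additive lebesgue_step.
Proof.
move=> F mF tF mUF; rewrite /lebesgue_step /pushforward preimage_bigcup.
apply: (@measure_semi_sigma_additive _ _ _ (lebesgue_measure \x mu)%E).
- by move=> k; rewrite -[X in measurable X]setTI; exact: measurable_rV_cons.
- apply/trivIsetP => /= i j _ _ ij; rewrite -preimage_setI.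
  by move/trivIsetP : tF => /(_ _ _ _ _ ij) ->//; rewrite preimage_set0.
- by rewrite -preimage_bigcup -[X in measurable X]setTI;
    exact: measurable_rV_cons.
Qed.

HB.instance Definition _ := isMeasure.Build _ _ _ lebesgue_step
  lebesgue_step0 lebesgue_step_ge0 lebesgue_step_sigma_additive.

Let lebesgue_step_sigma_finite : sigma_finite setT lebesgue_step.
Proof.
have [F FT mF] := sigma_finite_product (@lebesgue_measure R) mu.
exists (fun k => rV_uncons @^-1` F k).
  by rewrite -preimage_bigcup -FT preimage_setT.
move=> k; split.
  by rewrite -[X in measurable X]setTI; apply: measurable_rV_uncons; have [] := mF k.
rewrite /lebesgue_step /pushforward -comp_preimage.
rewrite (_ : rV_uncons \o rV_cons = id); last exact/funext/rV_consK.
by rewrite preimage_id; have [] := mF k.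
Qed.

HB.instance Definition _ := Measure_isSigmaFinite.Build _ _ _ lebesgue_step
  lebesgue_step_sigma_finite.

End lebesgue_step.

Fixpoint leb {R : realType} (n : nat) :
    {sigma_finite_measure set 'rV[R]_n -> \bar R} :=
  match n with
  | 0%N => \d_(0 : 'rV[R]_0)
  | n'.+1 => lebesgue_step (leb n')
  end.

Lemma leb_box {R : realType} (n : nat) (A : 'I_n -> set (measurableTypeR R)) :
  (forall i, measurable (A i)) ->
  leb n [set x | forall i, A i (x ord0 i)] =
  (\prod_(i < n) lebesgue_measure (A i))%E.
Proof.
elim: n A => [|n IHn] A mA.
  rewrite big_ord0 /= diracE mem_set//=.
  by case=> k /[dup]; rewrite {1}ltn0.
have mB : measurable [set x : 'rV[R]_n | forall i, A (lift ord0 i) (x ord0 i)].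
  rewrite [X in measurable X](_ : _ = \bigcap_(i in [set: 'I_n])
      [set x : 'rV[R]_n | A (lift ord0 i) (x ord0 i)]); last first.
    by apply/seteqP; split=> x h i; [move=> _; exact: (h i)|exact: (h i I)].
  apply: fin_bigcap_measurable => // i _.
  by rewrite -[X in measurable X]setTI; exact: (measurable_coord i).
rewrite big_ord_recl/= -(IHn (fun i => A (lift ord0 i)))//.
rewrite -product_measure1E//= /lebesgue_step /pushforward.
congr (_ _); apply/seteqP; split=> [[a x]/= h|[a x]/= [h0 h] i].
  split; first by have := h ord0; rewrite rV_cons0.
  by move=> i; have := h (lift ord0 i); rewrite rV_consS.
by case: (unliftP ord0 i) => [j ->|->]; rewrite ?rV_consS ?rV_cons0.
Qed.

Section definitions.
Context {R : realType} {n : nat}.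
Local Notation Rn := 'rV[R]_n.
Local Notation mu := (leb n : {measure set Rn -> \bar R}).

(* The norm that [matrix_normedtype] puts on ['rV[R]_n] is the sup norm, hence
   a separate Euclidean norm. *)
Definition enorm (x : Rn) : R := Num.sqrt (\sum_(i < n) x ord0 i ^+ 2).

Definition eball (c : Rn) (rho : R) : set Rn := [set x | enorm (x - c) < rho].

Definition vol (B : set Rn) : R := fine (mu B).

Definition loc_integrable (f : Rn -> \bar R) : Prop :=
  measurable_fun setT f /\
  forall c rho, 0 < rho -> mu.-integrable (eball c rho) f.

Definition average (f : Rn -> R) (B : set Rn) : R :=
  (vol B)^-1 * \int[mu]_(x in B) f x.

Definition cond_S (alpha : R) (K : Rn -> R) : Prop :=
  exists2 C : R, 0 < C & forall s : R, 0 < s ->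
    (\int[mu]_(x in [set x | (s < enorm x <= 2 * s)%R]) `|K x|%:E
       <= (C * s `^ alpha)%:E)%E.

Definition cond_Hstar_infty (alpha eta : R) (K : Rn -> R) : Prop :=
  exists2 C : R, 0 < C & forall x x' y : Rn,
    2 * enorm (x - x') <= enorm (x - y) ->
    `|K (x - y) - K (x' - y)| + `|K (y - x) - K (y - x')|
      <= C * (enorm (x - x') `^ eta / enorm (x - y) `^ (n%:R - alpha + eta)).

Definition lip_bound (delta : R) (b : Rn -> R) (C : R) : Prop :=
  0 < C /\ forall x y : Rn, `|b x - b y| <= C * enorm (x - y) `^ delta.

Definition Lambda (delta : R) (b : Rn -> R) : Prop :=
  exists C : R, lip_bound delta b C.

Definition Lambda_norm (delta : R) (b : Rn -> R) : R :=
  inf [set C | lip_bound delta b C].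

Definition weight (w : Rn -> R) : Prop :=
  (forall x, 0 <= w x) /\ loc_integrable (EFin \o w).

Definition muckenhoupt_A1 (v : Rn -> \bar R) : Prop :=
  [/\ forall x, (0 <= v x)%E, loc_integrable v &
      exists2 C : R, 0 < C & forall c rho, 0 < rho ->
        {ae mu, forall x, eball c rho x ->
          ((vol (eball c rho))^-1%:E * \int[mu]_(y in eball c rho) v y
             <= C%:E * v x)%E}].

Definition conj_exponent (r : R) : R := (1 - r^-1)^-1.

(* The inverse is taken in [\bar R], where [0^-1 = +oo]; in [R] one would get
   [0 `^ (- r') = 0]. *)
Definition A_infty (r : R) (w : Rn -> R) : Prop :=
  weight w /\ muckenhoupt_A1 (fun x => ((w x `^ conj_exponent r)%:E^-1)%E).

Definition Lp_weighted_norm (r : R) (w f : Rn -> R) : \bar R :=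
  Lnorm mu r%:E (fun x => (f x * w x)%:E).

Definition Lp_weighted (r : R) (w f : Rn -> R) : Prop :=
  measurable_fun setT f /\ (Lp_weighted_norm r w f < +oo)%E.

Definition wlip_norm (w : Rn -> R) (sigma : R) (f : Rn -> R) : \bar R :=
  ereal_sup [set t | exists c rho, 0 < rho /\ let B := eball c rho in
    t = (Lnorm mu +oo (fun x => (w x * \1_B x)%:E)
         * ((vol B `^ (1 + sigma / n%:R))^-1)%:E
         * \int[mu]_(x in B) `|f x - average f B|%:E)%E].

Definition comm_kernel (K b : Rn -> R) (m : nat) (x y : Rn) : R :=
  (b x - b y) ^+ m * K (x - y).

Definition commutator (K b : Rn -> R) (m : nat) (f : Rn -> R) (x : Rn) : R :=
  \int[mu]_y (comm_kernel K b m x y * f y).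

Definition commutator_converges (K b : Rn -> R) (m : nat) (f : Rn -> R) : Prop :=
  {ae mu, forall x,
    mu.-integrable setT (fun y => (comm_kernel K b m x y * f y)%:E)}.

(* For [f] in [L^r_w] the integral defining [commutator] may diverge at
   infinity. As usual for operators into spaces whose norm ignores additive
   constants, the formal commutator is then the class modulo constants of
   the functions [g] whose increments are given by the kernel differences.
   When [commutator_converges], [commutator K b m f] is such a [g]. *)
Definition is_commutator (K b : Rn -> R) (m : nat) (f g : Rn -> R) : Prop :=
  measurable_fun setT g /\
  {ae mu, forall x, {ae mu, forall x',
    let d y := (comm_kernel K b m x y - comm_kernel K b m x' y) * f y in
    mu.-integrable setT (fun y => (d y)%:E) /\
    g x - g x' = \int[mu]_y d y}}.

End definitions.

(* Main.v *)
Require Import Defs.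
From HB Require Import structures.
From mathcomp Require Import all_boot all_order all_algebra.
From mathcomp Require Import all_classical all_reals all_analysis measurable_realfun.
From mathcomp Require Import ess_sup_inf ring lra.

Set Implicit Arguments.
Unset Strict Implicit.
Unset Printing Implicit Defensive.

Import Order.TTheory GRing.Theory Num.Theory.
Import numFieldNormedType.Exports.

Local Open Scope classical_set_scope.
Local Open Scope ring_scope.

(** The estimate rests on splitting the commutator, on a ball [B = B(c, rho)],
    into a local part (integration over [B(c, 5 rho)]) and a far part.

    The local part is estimated in the mean: by Tonelli and translation invariance
    the integral over [B] of [\int |K (x - y)| |x - y|^(m delta) |f y| dy] is at
    most a constant times [rho^(m delta + alpha) \int_(B(c, 5 rho)) |f|], because
    the annular condition, summed over dyadic annuli, bounds the integral of [|K|]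
    over a ball of radius [s] by [s^alpha] ([kernel_integral],
    [integral_local_potential]).

    For the far part only differences of the kernel at two points of [B] matter.
    The two conditions on [K] together give the pointwise bound
    [|K z| <= C |z|^(alpha - n)] ([kernel_size]), and then a difference of
    commutator kernels gains either [(rho / |y - c|)^eta], from the smoothness of
    [K], or [(rho / |y - c|)^delta], from that of [b] ([comm_kernel_far]). When
    [\int_(B(c, t)) |f| <= A t^(n - n/r)] for all [t >= rho], summing over dyadic
    annuli gives a convergent geometric series exactly because the target order
    [sigma = m delta + alpha - n/r] is smaller than [eta] and than [delta]
    ([integral_far_le], [far_part_le]). Altogether a function [g] representing the
    commutator differs on [B] from a constant by at most the local part at [x] plus
    [C A rho^sigma] ([commutator_minus_const]), whence
    [\int_B |g - g_B| <= C A rho^(n + sigma)] ([commutator_oscillation]).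

    The weight enters only through [A]. Hoelder's inequality bounds
    [\int_(B(c, t)) |f|] by the norm of [f w] times the power [1/r'] of
    [\int_(B(c, t)) w^(-r')], while the [A_1] condition on [w^(-r')] says that the
    essential supremum of [w] on [B] is at most a constant times [(|B(c, t)| /
    \int_(B(c, t)) w^(-r'))^(1/r')]. In the product the integrals of [w^(-r')]
    cancel ([weighted_growth]), and [A] times the essential supremum of [w] on [B]
    is controlled by the norm of [f w].

    The same growth of [f] makes the kernel differences integrable at almost all
    pairs of points, those where the local part converges ([good_point]), which
    gives the existence of the commutator modulo constants. *)

(** * Euclidean geometry and Lebesgue measure on row vectors *)

Section euclidean.
Context {R : realType} {n : nat}.
Implicit Types (x y z c : 'rV[R]_n) (rho : R).

Lemma enorm_ge0 x : 0 <= enorm x.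
Proof. exact: sqrtr_ge0. Qed.

Lemma sqr_enorm x : enorm x ^+ 2 = \sum_(i < n) x ord0 i ^+ 2.
Proof. by rewrite sqr_sqrtr// sumr_ge0// => i _; exact: sqr_ge0. Qed.

Lemma enorm0 : enorm (0 : 'rV[R]_n) = 0.
Proof.
rewrite /enorm big1 ?sqrtr0// => i _.
by rewrite mxE expr0n.
Qed.

Lemma enormN x : enorm (- x) = enorm x.
Proof. by congr Num.sqrt; apply: eq_bigr => i _; rewrite mxE sqrrN. Qed.

Lemma enormBC x y : enorm (x - y) = enorm (y - x).
Proof. by rewrite -enormN opprB. Qed.

(** Cauchy-Schwarz, read off from the nonnegativity of
    [\sum_i (B x_i - D y_i) ^+ 2 = B * (A * B - D ^+ 2)]. *)
Lemma dot_le_enorm x y :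
  \sum_(i < n) x ord0 i * y ord0 i <= enorm x * enorm y.
Proof.
pose A := \sum_(i < n) x ord0 i ^+ 2.
pose B := \sum_(i < n) y ord0 i ^+ 2.
pose D := \sum_(i < n) x ord0 i * y ord0 i.
have A0 : 0 <= A by apply: sumr_ge0 => i _; exact: sqr_ge0.
have B0 : 0 <= B by apply: sumr_ge0 => i _; exact: sqr_ge0.
have H : 0 <= B * (A * B - D ^+ 2).
  have -> : B * (A * B - D ^+ 2) =
      \sum_(i < n) (B * x ord0 i - D * y ord0 i) ^+ 2.
    have E i : (B * x ord0 i - D * y ord0 i) ^+ 2 =
        B ^+ 2 * x ord0 i ^+ 2 - 2 * B * D * (x ord0 i * y ord0 i)
        + D ^+ 2 * y ord0 i ^+ 2.
      by rewrite sqrrB; lra.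
    under eq_bigr => i _ do rewrite E.
    by rewrite big_split sumrB/= -!mulr_sumr -/A -/B -/D; lra.
  by apply: sumr_ge0 => i _; exact: sqr_ge0.
have [B_gt0|] := ltP 0 B; last first.
  move=> B_le0; have {B_le0}B_eq0 : B = 0 by apply/eqP; rewrite eq_le B_le0.
  rewrite big1 ?mulr_ge0 ?enorm_ge0// => i _.
  move/eqP: B_eq0; rewrite psumr_eq0; last by move=> j _; exact: sqr_ge0.
  by move=> /allP/(_ i (mem_index_enum _)); rewrite sqrf_eq0 => /eqP ->; rewrite mulr0.
apply: (le_trans (ler_norm _)).
rewrite -ler_sqr ?nnegrE ?mulr_ge0 ?enorm_ge0//.
rewrite real_normK ?num_real// exprMn !sqr_enorm -/A -/B -/D.
by rewrite -subr_ge0 -(pmulr_rge0 _ B_gt0).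
Qed.

Lemma ler_enormD x y : enorm (x + y) <= enorm x + enorm y.
Proof.
rewrite -ler_sqr ?nnegrE ?addr_ge0 ?enorm_ge0// sqrrD !sqr_enorm.
under eq_bigr => i _ do rewrite mxE sqrrD.
by rewrite !big_split/= lerD2r lerD2l mulr2n lerD// dot_le_enorm.
Qed.

Lemma ler_enormB x y z : enorm (x - z) <= enorm (x - y) + enorm (y - z).
Proof. by rewrite -[x - z](subrKA y) ler_enormD. Qed.

Lemma coord_le_enorm x i : `|x ord0 i| <= enorm x.
Proof.
rewrite -ler_sqr ?nnegrE ?enorm_ge0// sqr_enorm real_normK ?num_real//.
by rewrite (bigD1 i)//= lerDl sumr_ge0// => j _; exact: sqr_ge0.
Qed.

Lemma enorm_le_sum x : enorm x <= \sum_(i < n) `|x ord0 i|.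
Proof.
have s0 : 0 <= \sum_(i < n) `|x ord0 i| by exact: sumr_ge0.
rewrite -ler_sqr ?nnegrE ?enorm_ge0// sqr_enorm.
rewrite [leRHS]expr2 mulr_suml; apply: ler_sum => i _.
rewrite -real_normK ?num_real// expr2 ler_wpM2l//.
by rewrite (bigD1 i)//= lerDl sumr_ge0.
Qed.

Lemma enorm_eq0 x : enorm x = 0 -> x = 0.
Proof.
move=> x0; apply/rowP => i; rewrite mxE; apply/eqP; rewrite -normr_eq0.
by rewrite eq_le normr_ge0 andbT -x0 coord_le_enorm.
Qed.

Lemma measurable_funB_rV d (T : measurableType d) (f g : T -> 'rV[R]_n) :
  measurable_fun setT f -> measurable_fun setT g ->
  measurable_fun setT (fun t => f t - g t).
Proof.
move=> mf mg; apply: measurable_fun_rV => i; under eq_fun do rewrite !mxE.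
by apply: measurable_funB; exact: (measurableT_comp (measurable_coord i)).
Qed.

Lemma measurable_enorm d (T : measurableType d) (f : T -> 'rV[R]_n) :
  measurable_fun setT f -> measurable_fun setT (fun t => enorm (f t)).
Proof.
move=> mf; rewrite /enorm.
have msqrt : measurable_fun [set: R] (@Num.sqrt R).
  by apply: continuous_measurable_fun; exact: sqrt_continuous.
apply: (measurableT_comp msqrt).
apply: measurable_sum => i; apply: measurable_funX.
exact: (measurableT_comp (measurable_coord i)).
Qed.

Lemma measurable_enormB c : measurable_fun setT (fun x => enorm (x - c)).
Proof.
by apply: measurable_enorm; exact: measurable_funB_rV.
Qed.

Lemma measurable_eball c rho : measurable (eball c rho).
Proof.
have := @measurable_enormB c measurableT _ (measurable_itv `]-oo, rho[).
rewrite setTI; congr measurable; apply/seteqP; split => x /=; by rewrite in_itv.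
Qed.

Definition cube c rho : set 'rV[R]_n :=
  [set x | forall i, `]c ord0 i - rho, c ord0 i + rho[%classic (x ord0 i)].

Lemma measurable_cube c rho : measurable (cube c rho).
Proof.
rewrite (_ : cube c rho = \bigcap_(i in [set: 'I_n])
  [set x : 'rV[R]_n | `]c ord0 i - rho, c ord0 i + rho[%classic (x ord0 i)]).
  apply: fin_bigcap_measurable => // i _.
  rewrite -[X in measurable X]setTI.
  exact: (measurable_coord i measurableT
    (measurable_itv `]c ord0 i - rho, c ord0 i + rho[)).
by apply/seteqP; split=> x h i; [move=> _; exact: (h i)|exact: (h i I)].
Qed.

Lemma leb_cube c rho : 0 <= rho -> leb n (cube c rho) = ((2 * rho) ^+ n)%:E.
Proof.
move=> rho0; rewrite (leb_box (A := fun i => `]c ord0 i - rho, c ord0 i + rho[%classic));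
  last by move=> i; exact: measurable_itv.
have E i : lebesgue_measure `]c ord0 i - rho, c ord0 i + rho[%classic = (2 * rho)%:E.
  rewrite lebesgue_measure_itv/= lte_fin; case: ifPn => [_|].
    by rewrite -EFinB; congr EFin; lra.
  rewrite -leNgt => h; have -> : rho = 0 by lra.
  by rewrite mulr0.
under eq_bigr => i _ do rewrite E.
by rewrite prodEFin prodr_const card_ord.
Qed.

Lemma eball_sub_cube c rho : eball c rho `<=` cube c rho.
Proof.
move=> x /= xc i; have := le_lt_trans (coord_le_enorm (x - c) i) xc.
by rewrite !mxE /= in_itv/= ltr_distl.
Qed.

Lemma cube_sub_eball c rho : (0 < n)%N -> cube c (rho / n%:R) `<=` eball c rho.
Proof.
move=> n0 x xc /=; apply: (le_lt_trans (enorm_le_sum _)).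
have -> : rho = \sum_(i < n) (rho / n%:R).
  by rewrite sumr_const card_ord -[RHS]mulr_natr divfK// pnatr_eq0 -lt0n.
apply: ltr_sum.
  by apply/hasP; exists (Ordinal n0) => //; rewrite mem_index_enum.
by move=> i _; have := xc i; rewrite /= in_itv/= !mxE ltr_distl.
Qed.

Lemma leb_eball_le c rho : 0 < rho ->
  (leb n (eball c rho) <= ((2 * rho) ^+ n)%:E)%E.
Proof.
move=> rho0; rewrite -(leb_cube c (ltW rho0)).
by apply: le_measure; rewrite ?inE;
  [exact: measurable_eball|exact: measurable_cube|exact: eball_sub_cube].
Qed.

Lemma leb_eball_ge c rho : (0 < n)%N -> 0 < rho ->
  (((2 * (rho / n%:R)) ^+ n)%:E <= leb n (eball c rho))%E.
Proof.
move=> n0 rho0.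
have r0 : 0 <= rho / n%:R by apply: divr_ge0 => //; exact: ltW.
rewrite -(leb_cube c r0).
by apply: le_measure; rewrite ?inE;
  [exact: measurable_cube|exact: measurable_eball|exact: cube_sub_eball].
Qed.

Lemma leb_eball_fin c rho : 0 < rho -> leb n (eball c rho) \is a fin_num.
Proof.
move=> rho0; rewrite ge0_fin_numE//.
by rewrite (le_lt_trans (leb_eball_le c rho0))// ltry.
Qed.

Lemma vol_le c rho : 0 < rho -> vol (eball c rho) <= (2 * rho) ^+ n.
Proof.
by move=> r0; rewrite -lee_fin /vol fineK ?leb_eball_fin// leb_eball_le.
Qed.

Lemma vol_ge c rho : (0 < n)%N -> 0 < rho ->
  (2 * (rho / n%:R)) ^+ n <= vol (eball c rho).
Proof.
by move=> n0 r0; rewrite -lee_fin /vol fineK ?leb_eball_fin// leb_eball_ge.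
Qed.

Lemma vol_gt0 c rho : (0 < n)%N -> 0 < rho -> 0 < vol (eball c rho).
Proof.
move=> n0 r0; apply: lt_le_trans (vol_ge c n0 r0).
by rewrite exprn_gt0// mulr_gt0// divr_gt0// ltr0n.
Qed.

Lemma leb_eballE c rho : 0 < rho -> leb n (eball c rho) = (vol (eball c rho))%:E.
Proof. by move=> r0; rewrite /vol fineK// leb_eball_fin. Qed.

Lemma leb_set10 c : (0 < n)%N -> leb n [set c] = 0%E.
Proof.
move=> n0.
have -> : [set c] = [set x : 'rV[R]_n | forall i, [set c ord0 i] (x ord0 i)].
  apply/seteqP; split=> [x -> //|x h]; apply/rowP => i; exact: (h i).
rewrite (leb_box (A := fun i => [set c ord0 i])); last by move=> i; exact: measurable_set1.
by rewrite (bigD1 (Ordinal n0))//= lebesgue_measure_set1 mul0e.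
Qed.

End euclidean.

Section translation.
Context {R : realType}.

Lemma lebesgue_measure_shift (t : R) (A : set (measurableTypeR R)) :
  measurable A ->
  lebesgue_measure ((fun a : measurableTypeR R => a + t : measurableTypeR R) @^-1` A)
    = lebesgue_measure A.
Proof.
move=> mA; pose phi := fun a : measurableTypeR R => a + t : measurableTypeR R.
have mphi : measurable_fun setT phi by exact: measurable_funD.
pose phi_ : {mfun _ >-> _} := HB.pack phi (isMeasurableFun.Build _ _ _ _ _ mphi).
symmetry.
apply: (@lebesgue_measure_unique R (pushforward lebesgue_measure phi_) _ A mA).
move=> _ [[a b] _ <-] /=.
rewrite /pushforward [X in _ = lebesgue_measure X](_ : _ = `](a - t), (b - t)]%classic); last first.
  by apply/seteqP; split => x /=; rewrite !in_itv/= /phi ltrBlDr lerBrDr.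
rewrite !lebesgue_measure_itv/= !lte_fin ltrD2r; case: ifPn => // _.
by rewrite -!EFinB; congr EFin; lra.
Qed.

(** By induction on the dimension: the measure on [R^(n+1)] is a product, and the
    product measure is determined by its values on measurable rectangles. *)
Lemma leb_shift n (t : 'rV[R]_n) (A : set 'rV[R]_n) : measurable A ->
  leb n ((fun x => x + t) @^-1` A) = leb n A.
Proof.
elim: n t A => [|n IHn] t A mA.
  by congr (leb 0%N _); apply/seteqP; split => x /=; rewrite (thinmx0 t) addr0.
pose t' : 'rV[R]_n := \row_(i < n) t ord0 (lift ord0 i).
pose tau (p : measurableTypeR R * 'rV[R]_n) : measurableTypeR R * 'rV[R]_n :=
  (p.1 + t ord0 ord0, p.2 + t').
have mtau : measurable_fun setT tau.
  apply: measurable_fun_pair => /=.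
    by apply: measurable_funD => //; exact: measurable_fst.
  apply: measurable_fun_rV => i; under eq_fun do rewrite !mxE.
  apply: measurable_funD => //.
  exact: measurableT_comp (measurable_coord i) measurable_snd.
pose tau_ : {mfun _ >-> _} := HB.pack tau (isMeasurableFun.Build _ _ _ _ _ mtau).
have consD p : rV_cons p + t = rV_cons (tau p).
  apply/rowP => i; rewrite mxE; case: (unliftP ord0 i) => [j ->|->].
    by rewrite !rV_consS !mxE.
  by rewrite !rV_cons0.
have mA' : measurable (@rV_cons R n @^-1` A).
  by rewrite -[X in measurable X]setTI; exact: measurable_rV_cons.
have H (B : set (measurableTypeR R)) (C : set 'rV[R]_n) :
    measurable B -> measurable C ->
  pushforward (lebesgue_measure \x leb n)%E tau_ (B `*` C) =
    (lebesgue_measure B * leb n C)%E.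
  move=> mB mC; rewrite /pushforward.
  rewrite (_ : _ @^-1` _ =
    ((fun a : measurableTypeR R => a + t ord0 ord0) @^-1` B)
      `*` ((fun x => x + t') @^-1` C)); last by [].
  have mB' : measurable
      ((fun a : measurableTypeR R => a + t ord0 ord0 : measurableTypeR R) @^-1` B).
    by rewrite -[X in measurable X]setTI; apply: measurable_funD.
  have mC' : measurable ((fun x : 'rV[R]_n => x + t') @^-1` C).
    rewrite -[X in measurable X]setTI; apply: measurable_fun_rV => // i.
    under eq_fun do rewrite !mxE.
    by apply: measurable_funD => //; exact: measurable_coord.
  rewrite product_measure1E//; congr (_ * _)%E; last exact: IHn.
  exact: lebesgue_measure_shift.
rewrite /= /lebesgue_step /pushforward (product_measure_unique H mA').
rewrite /pushforward; congr ((_ \x _)%E _).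
by apply/seteqP; split => p /=; rewrite consD.
Qed.

Lemma ge0_integral_leb_shift n (y : 'rV[R]_n) (F : 'rV[R]_n -> \bar R) :
  measurable_fun setT F -> (forall x, 0 <= F x)%E ->
  (\int[leb n]_x F (x - y)%R = \int[leb n]_x F x)%E.
Proof.
move=> mF F0.
have mphi : measurable_fun setT (fun x : 'rV[R]_n => x - y).
  exact: measurable_funB_rV.
rewrite -(@ge0_integral_pushforward _ _ _ _ _ _ mphi (leb n) setT F)//.
by apply: eq_measure_integral => A mA _; exact: (leb_shift (- y) mA).
Qed.

End translation.

(** * Dyadic decompositions *)

Section dyadic_scales.
Context {R : realType}.
Implicit Types (a s t q : R).

Lemma expr_powR a t k : 0 <= a -> (a ^+ k) `^ t = (a `^ t) ^+ k.
Proof.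
move=> a0; elim: k => [|k IHk]; first by rewrite !expr0 powR1.
by rewrite !exprS powRM ?exprn_ge0// IHk.
Qed.

Lemma powR2_lt1 t : t < 0 -> 2 `^ t < 1.
Proof.
move=> t0; rewrite -[t]opprK powRN invf_lt1 ?powR_gt0//.
rewrite [ltLHS](_ : _ = 1 `^ (- t)); last by rewrite powR1.
by rewrite gt0_ltr_powR ?nnegrE ?oppr_gt0// ltr1n.
Qed.

Lemma dyadic_ge1 t : 1 <= t -> exists k, 2 ^+ k <= t < 2 ^+ k.+1.
Proof.
move=> t1.
have ex : exists k, t < 2 ^+ k.
  exists (Num.truncn t).+1; apply: (lt_trans (truncnS_gt t)).
  by rewrite -natrX ltr_nat ltn_expl.
case: (ex_minnP ex) => -[|k] tk kmin.
  by move: tk; rewrite expr0 ltNge t1.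
exists k; rewrite tk andbT leNgt; apply/negP => /kmin.
by rewrite ltnn.
Qed.

Lemma dyadic_le1 t : 0 < t <= 1 -> exists k, 2^-1 ^+ k.+1 < t <= 2^-1 ^+ k.
Proof.
move=> /andP[t0 t1].
have [|k /andP[kt tk]] := @dyadic_ge1 t^-1; first by rewrite invf_ge1.
exists k; rewrite !exprVn; apply/andP; split.
  by rewrite -ltf_pV2 ?posrE ?invr_gt0 ?exprn_gt0// invrK.
by rewrite -lef_pV2 ?posrE ?invr_gt0 ?exprn_gt0// invrK.
Qed.

Lemma nneseries_geometric_le (u : nat -> \bar R) a q : 0 <= a -> 0 <= q < 1 ->
  (forall k, 0 <= u k <= (a * q ^+ k)%:E)%E ->
  (\sum_(0 <= k <oo) u k <= (a / (1 - q))%:E)%E.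
Proof.
move=> a0 /andP[q0 q1] ub; apply: lime_le.
  by apply: is_cvg_nneseries => k _ _; have /andP[] := ub k.
apply: nearW => N.
apply: (@le_trans _ _ (a * (1 - q ^+ N) / (1 - q))%:E); last first.
  rewrite lee_fin ler_wpM2r ?invr_ge0 ?subr_ge0 ?(ltW q1)//.
  by rewrite ler_piMr// gerBl exprn_ge0.
have q1' : 1 - q != 0 by rewrite subr_eq0 gt_eqF.
elim: N => [|N IHN]; first by rewrite big_nil expr0 subrr mulr0 mul0r.
rewrite big_nat_recr//=.
have /andP[_ uN] := ub N; apply: (le_trans (leeD IHN uN)).
rewrite -EFinD lee_fin le_eqVlt; apply/orP; left; apply/eqP.
by rewrite -[X in _ + X](mulfK q1') -mulrDl; congr (_ / _); rewrite exprS; lra.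
Qed.

End dyadic_scales.

Section dyadic_integrals.
Local Open Scope ereal_scope.

Lemma ge0_le_integral_bigcup d (T : measurableType d) (R : realType)
    (mu : {measure set T -> \bar R}) (F : (set T)^nat) (D : set T)
    (f : T -> \bar R) :
  (forall k, measurable (F k)) -> measurable D -> D `<=` \bigcup_k F k ->
  measurable_fun setT f -> (forall x, 0 <= f x) ->
  \int[mu]_(x in D) f x <= \sum_(k <oo) \int[mu]_(x in F k) f x.
Proof.
move=> mF mD DF mf f0.
have mFD k : measurable (seqDU F k).
  by apply: measurableD => //; exact: bigsetU_measurable.
apply: (@le_trans _ _ (\int[mu]_(x in \bigcup_k F k) f x)).
  apply: ge0_subset_integral => //.
  - exact: bigcup_measurable.
  - exact: measurable_funS mf.
have mfU : measurable_fun (\bigcup_k seqDU F k) f by exact: measurable_funS mf.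
have tF : trivIset setT (seqDU F) by exact: trivIset_seqDU.
rewrite seqDU_bigcup_eq ge0_integral_bigcup//.
apply: lee_nneseries => k *; first exact: integral_ge0.
apply: ge0_subset_integral => //; first exact: measurable_funTS.
by move=> x [].
Qed.

Context {R : realType} {n : nat}.
Local Notation mu := (leb n : {measure set 'rV[R]_n -> \bar R}).
Implicit Types (phi : 'rV[R]_n -> \bar R) (c : 'rV[R]_n).

Lemma measurable_enorm_itv c (i : interval R) :
  measurable [set x : 'rV[R]_n | enorm (x - c)%R \in i].
Proof.
have := @measurable_enormB _ _ c measurableT _ (measurable_itv i).
by rewrite setTI.
Qed.

Lemma measurable_rV_set1 c : measurable [set c].
Proof.
rewrite (_ : [set c] = [set x | enorm (x - c)%R \in `]-oo, 0%R]]).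
  exact: measurable_enorm_itv.
apply/seteqP; split=> [x ->|x] /=; rewrite in_itv/= ?subrr ?enorm0// => x0.
apply/eqP; rewrite -subr_eq0; apply/eqP/enorm_eq0/eqP.
by rewrite eq_le x0 enorm_ge0.
Qed.

Lemma integral_eball_indic c (rho : R) (h : 'rV[R]_n -> R) :
  \int[mu]_(y in eball c rho) `|h y|%:E = \int[mu]_y (`|h y| * \1_(eball c rho) y)%:E.
Proof.
rewrite [LHS]integral_mkcond; apply: eq_integral => y _.
by rewrite patchE indicE; case: ifPn => _; rewrite ?mulr1 ?mulr0.
Qed.

(** Summing an annular bound [C s^a], [a > 0], over the annuli shrinking to the
    origin gives a bound on balls: the scales form a geometric series. *)
Lemma integral_eball0_le phi (C a : R) : (0 < n)%N -> (0 < C)%R -> (0 < a)%R ->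
  measurable_fun setT phi -> (forall x, 0 <= phi x) ->
  (forall s : R, (0 < s)%R ->
    \int[mu]_(x in [set x | (s < enorm x <= 2 * s)%R]) phi x <= (C * s `^ a)%:E) ->
  exists2 C' : R, (0 < C')%R & forall s : R, (0 < s)%R ->
    \int[mu]_(x in eball 0%R s) phi x <= (C' * s `^ a)%:E.
Proof.
move=> n0 C0 a0 mphi phi0 annulus.
pose q : R := (2^-1 `^ a)%R.
have q0 : (0 < q)%R by rewrite powR_gt0.
have q1 : (q < 1)%R.
  rewrite [ltRHS](_ : _ = (1 `^ a)%R); last by rewrite powR1.
  by rewrite gt0_ltr_powR ?nnegrE ?invr_ge0// invf_lt1// ltr1n.
exists (C * q / (1 - q))%R; first by rewrite divr_gt0 ?mulr_gt0// subr_gt0.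
move=> s s0.
have mphiB : measurable_fun (eball 0%R s) phi by exact: measurable_funS mphi.
rewrite (ge0_negligible_integral (measurable_rV_set1 0%R) (measurable_eball 0%R s)
  mphiB) //; last exact: leb_set10.
pose r k : R := (s * 2^-1 ^+ k.+1)%R.
have r0 k : (0 < r k)%R by rewrite mulr_gt0// exprn_gt0// invr_gt0.
pose F k := [set x : 'rV[R]_n | (r k < enorm x <= 2 * r k)%R].
apply: (le_trans (@ge0_le_integral_bigcup _ _ _ mu F _ _ _ _ _ _ _)) => //.
- move=> k; have := @measurable_enorm_itv 0%R `]r k, (2 * r k)%R].
  by congr measurable; apply/seteqP; split => x /=; rewrite in_itv/= subr0.
- apply: measurableD; first exact: measurable_eball.
  exact: measurable_rV_set1.
- move=> x []; rewrite /eball/= subr0 => xs x0.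
  have ex : (0 < enorm x)%R.
    rewrite lt_neqAle enorm_ge0 andbT eq_sym; apply/eqP => /enorm_eq0.
    exact: x0.
  have [|k /andP[kx xk]] := @dyadic_le1 R (enorm x / s)%R.
    by rewrite divr_gt0//= ler_pdivrMr// mul1r ltW.
  exists k => //=; apply/andP; split.
    by rewrite /r mulrC -ltr_pdivlMr.
  by rewrite /r exprS mulrCA mulVKf ?pnatr_eq0// mulrC -ler_pdivrMr.
rewrite (_ : (C * q / (1 - q) * s `^ a)%R = (C * s `^ a * q) / (1 - q))%R; last first.
  by ring.
apply: nneseries_geometric_le.
- by rewrite !mulr_ge0 ?powR_ge0// ltW.
- by rewrite q1 andbT ltW.
move=> k; apply/andP; split; first exact: integral_ge0.
apply: (le_trans (annulus _ (r0 k))); rewrite lee_fin.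
rewrite /r powRM ?exprn_ge0 ?invr_ge0 ?(ltW s0)//.
by rewrite expr_powR ?invr_ge0// exprS !mulrA.
Qed.

(** Dually, a growth bound [A t^p] on large balls makes [phi |.|^(-s)] integrable
    at infinity as soon as [p < s]. *)
Lemma integral_far_le phi c (A p s rho : R) :
  (0 <= A)%R -> (0 < s)%R -> (p < s)%R -> (0 < rho)%R ->
  measurable_fun setT phi -> (forall x, 0 <= phi x) ->
  (forall t : R, (rho <= t)%R ->
    \int[mu]_(x in eball c t) phi x <= (A * t `^ p)%:E) ->
  \int[mu]_(x in [set x | (rho <= enorm (x - c))%R])
      (phi x * (enorm (x - c)%R `^ (- s))%:E)
    <= (2 `^ p / (1 - 2 `^ (p - s)) * (A * rho `^ (p - s)))%:E.
Proof.
move=> A0 s0 ps rho0 mphi phi0 ball.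
pose q : R := (2 `^ (p - s))%R.
have q0 : (0 < q)%R by rewrite powR_gt0.
have q1 : (q < 1)%R by rewrite powR2_lt1// subr_lt0.
pose r k : R := (rho * 2 ^+ k)%R.
have r0 k : (0 < r k)%R by rewrite mulr_gt0// exprn_gt0.
pose psi x := phi x * (enorm (x - c)%R `^ (- s))%:E.
have psi0 x : 0 <= psi x by rewrite mule_ge0// lee_fin powR_ge0.
have mpsi : measurable_fun setT psi.
  apply: emeasurable_funM => //; apply/measurable_EFinP.
  exact: (measurableT_comp (measurable_powR _) (measurable_enormB c)).
pose F k := [set x : 'rV[R]_n | (r k <= enorm (x - c) < r k.+1)%R].
have mF k : measurable (F k).
  have := @measurable_enorm_itv c `[r k, r k.+1[.
  by congr measurable; apply/seteqP; split => x /=; rewrite in_itv/=.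
apply: (le_trans (@ge0_le_integral_bigcup _ _ _ mu F _ _ _ _ _ _ _)) => //.
- have := @measurable_enorm_itv c `[rho, +oo[.
  by congr measurable; apply/seteqP; split => x /=; rewrite in_itv/= andbT.
- move=> x /= xrho.
  have [|k /andP[kx xk]] := @dyadic_ge1 R (enorm (x - c) / rho)%R.
    by rewrite ler_pdivlMr// mul1r.
  exists k => //=; apply/andP; split.
    by rewrite /r mulrC -ler_pdivlMr.
  by rewrite /r mulrC -ltr_pdivrMr.
rewrite (_ : (_ * (A * _))%R = (2 `^ p * (A * rho `^ (p - s))) / (1 - q))%R; last first.
  by ring.
apply: nneseries_geometric_le.
- by rewrite !mulr_ge0 ?powR_ge0.
- by rewrite q1 andbT ltW.
move=> k; apply/andP; split.
  by apply: integral_ge0 => x _; exact: psi0.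
apply: (@le_trans _ _ (\int[mu]_(x in eball c (r k.+1)) ((r k `^ (- s))%:E * phi x))).
  apply: (@le_trans _ _ (\int[mu]_(x in F k) ((r k `^ (- s))%:E * phi x))).
    apply: ge0_le_integral => //.
    - by move=> x _; exact: psi0.
    - exact: measurable_funS mpsi.
    - by apply: measurable_funTS; exact: emeasurable_funM.
    move=> x /= /andP[kx _]; rewrite /psi muleC lee_wpmul2r// lee_fin.
    rewrite !powRN lef_pV2 ?posrE ?powR_gt0// ?(lt_le_trans (r0 k))//.
    by apply: ge0_ler_powR; rewrite ?nnegrE ?enorm_ge0 ?(ltW s0) ?(ltW (r0 k)).
  apply: ge0_subset_integral => //.
  - exact: measurable_eball.
  - by apply: measurable_funTS; exact: emeasurable_funM.
  - by move=> x _; rewrite mule_ge0// lee_fin powR_ge0.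
  - by move=> x /= /andP[].
rewrite ge0_integralZl//; last 3 first.
- exact: measurable_eball.
- exact: measurable_funTS.
- by rewrite lee_fin powR_ge0.
have rr : (rho <= r k.+1)%R.
  by rewrite ler_peMr ?(ltW rho0)// exprn_ege1// ler1n.
apply: (@le_trans _ _ ((r k `^ (- s))%:E * (A * r k.+1 `^ p)%:E)).
  by rewrite lee_wpmul2l ?lee_fin ?powR_ge0// ball.
rewrite -EFinM lee_fin le_eqVlt; apply/orP; left; apply/eqP.
rewrite /r !powRM ?exprn_ge0 ?(ltW rho0)//.
rewrite !expr_powR// exprS /q !powRD ?pnatr_eq0 ?(gt_eqF rho0) ?implybT//.
by rewrite exprMn; ring.
Qed.

End dyadic_integrals.

(** * Size and smoothness of the kernel *)

Section kernel.
Context {R : realType} {n : nat}.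
Local Notation mu := (leb n : {measure set 'rV[R]_n -> \bar R}).
Variables (alpha eta : R) (K : 'rV[R]_n -> R).
Hypotheses (n_gt0 : (0 < n)%N) (eta_gt0 : 0 < eta).
Hypothesis mK : measurable_fun setT K.

(** The smoothness condition lets [K z] be compared with its mean over a ball of
    radius [|z| / 4], and the annular condition bounds that mean. *)
Lemma kernel_size : cond_S alpha K -> cond_Hstar_infty alpha eta K -> 0 < alpha ->
  exists2 C : R, 0 < C & forall z, 0 < enorm z -> `|K z| <= C * enorm z `^ (alpha - n%:R).
Proof.
move=> [CS CS0 HS] [CH CH0 HH] alpha0.
(* [v0 t^n] is the volume of a cube contained in a ball of radius [t / 4]. *)
pose v0 : R := (2 / (4 * n%:R)) ^+ n.
have v00 : 0 < v0.
  by rewrite exprn_gt0// divr_gt0// mulr_gt0// ltr0n.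
exists (CS / v0 + CH); first by rewrite addr_gt0// divr_gt0.
move=> z; set t := enorm z => t0.
pose B := eball z (t / 4).
have t40 : 0 < t / 4 by rewrite divr_gt0.
have pt : t `^ (alpha - n%:R) = t `^ alpha / t ^+ n.
  rewrite powRB; last by rewrite (gt_eqF t0) implybT.
  by rewrite powR_mulrn// ltW.
have smooth x : B x -> `|K z| <= `|K x| + CH * t `^ (alpha - n%:R).
  move=> Bx; have xz : enorm (z - x) <= t / 4 by rewrite enormBC ltW.
  have zx2 : 2 * enorm (z - x) <= enorm (z - 0).
    by rewrite subr0 -/t; have := enorm_ge0 (z - x); lra.
  have := HH z x 0 zx2; rewrite !subr0 !sub0r -/t => H.
  have {}H : `|K z - K x| <= CH * t `^ (alpha - n%:R).
    apply: le_trans (le_trans H _); first by rewrite lerDl.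
    apply: ler_wpM2l; first exact: ltW.
    have tn : t `^ (n%:R - alpha + eta) = t `^ eta / t `^ (alpha - n%:R).
      rewrite -powRB; last by rewrite (gt_eqF t0) implybT.
      by congr (_ `^ _); ring.
    rewrite tn invf_div mulrA ler_pdivrMr ?powR_gt0// mulrC.
    rewrite ler_wpM2l ?powR_ge0//.
    apply: ge0_ler_powR; rewrite ?nnegrE ?enorm_ge0 ?(ltW eta_gt0) ?(ltW t0)//.
    by apply: (le_trans xz); lra.
  by have := ler_normD (K x) (K z - K x); rewrite addrC subrK; lra.
have BS : B `<=` [set x | t * (3 / 4) < enorm x <= 2 * (t * (3 / 4))].
  move=> x; rewrite /B /eball /= => Bx.
  have h1 : t <= enorm (x - z) + enorm x.
    by have := ler_enormB z x 0; rewrite !subr0 enormBC.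
  have h2 : enorm x <= enorm (x - z) + t.
    by have := ler_enormB x z 0; rewrite !subr0.
  by apply/andP; split; lra.
have t34 : 0 < t * (3 / 4) by lra.
have mB : measurable B := measurable_eball _ _.
have mA : measurable [set x : 'rV[R]_n | t * (3 / 4) < enorm x <= 2 * (t * (3 / 4))].
  have := @measurable_enorm_itv R n 0 `]t * (3 / 4), 2 * (t * (3 / 4))].
  by congr measurable; apply/seteqP; split => x /=; rewrite in_itv/= subr0.
have mKa : measurable_fun setT (fun x => `|K x|%:E).
  by apply/measurable_EFinP; exact: measurableT_comp.
have IB : (\int[mu]_(x in B) `|K x|%:E <= (CS * t `^ alpha)%:E)%E.
  apply: (@le_trans _ _ (\int[mu]_(x in
      [set x | (t * (3 / 4) < enorm x <= 2 * (t * (3 / 4)))%R]) `|K x|%:E)%E).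
    by apply: ge0_subset_integral => //; exact: measurable_funS mKa.
  apply: (le_trans (HS _ t34)); rewrite lee_fin ler_wpM2l ?(ltW CS0)//.
  by apply: ge0_ler_powR; rewrite ?nnegrE ?(ltW alpha0)//; lra.
have main : ((`|K z| * vol B)%:E <=
    ((CS * t `^ alpha) + CH * t `^ (alpha - n%:R) * vol B)%R%:E)%E.
  rewrite EFinD 2!(EFinM _ (vol B)) -(leb_eballE z t40) -/B.
  rewrite -[leLHS]integral_cst//.
  apply: (@le_trans _ _ (\int[mu]_(x in B)
      (`|K x|%:E + (CH * t `^ (alpha - n%:R))%:E))%E).
    apply: ge0_le_integral => //=.
    by apply: emeasurable_funD => //; exact: measurable_funS mKa.
  rewrite ge0_integralD//.
  - by rewrite integral_cst// leeD2r.
  - exact: measurable_funS mKa.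
  - by move=> x _; rewrite lee_fin mulr_ge0 ?powR_ge0// ltW.
rewrite lee_fin in main.
have vB : v0 * t ^+ n <= vol B.
  have := vol_ge z n_gt0 t40; congr (_ <= _).
  by rewrite /v0 -exprMn; congr (_ ^+ _); rewrite invfM; ring.
have vB0 : 0 < vol B by exact: vol_gt0.
have tn0 : 0 < t ^+ n by rewrite exprn_gt0.
rewrite mulrDl -lerBlDr -(ler_pM2r vB0) mulrBl.
apply: (@le_trans _ _ (CS * t `^ alpha)); first lra.
have -> : CS / v0 * t `^ (alpha - n%:R) * vol B =
    CS * t `^ alpha * (vol B / (v0 * t ^+ n)).
  by rewrite pt invfM; ring.
rewrite ler_peMr ?mulr_ge0 ?powR_ge0 ?(ltW CS0)//.
by rewrite ler_pdivlMr ?mul1r// mulr_gt0.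
Qed.

Lemma kernel_integral : cond_S alpha K -> 0 < alpha ->
  exists2 C : R, 0 < C & forall s : R, 0 < s ->
    (\int[mu]_(x in eball 0 s) `|K x|%:E <= (C * s `^ alpha)%:E)%E.
Proof.
move=> [CS CS0 HS] alpha0.
apply: (@integral_eball0_le _ _ (fun x => `|K x|%:E) CS) => //.
by apply/measurable_EFinP; exact: measurableT_comp.
Qed.

End kernel.

(** * Pointwise estimates for the commutator kernel *)

Section powers.
Context {R : realType}.
Implicit Types (a u v : R).

Lemma powR_expr a t k : (a `^ t) ^+ k = a `^ (k%:R * t).
Proof. by rewrite mulrC powRrM powR_mulrn ?powR_ge0. Qed.

Lemma powR_comparable a u v : 0 < u -> u / 2 <= v <= 2 * u ->
  v `^ a <= 2 `^ `|a| * u `^ a.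
Proof.
move=> u0 /andP[uv vu]; have v0 : 0 < v by lra.
have [a0|a0] := leP 0 a.
  rewrite ger0_norm// -powRM//; last exact: ltW.
  by apply: ge0_ler_powR; rewrite ?nnegrE ?mulr_ge0 ?(ltW v0) ?(ltW u0).
have [e ae] : exists e, a = - e by exists (- a); rewrite opprK.
move: a0; rewrite {}ae oppr_lt0 normrN => e0; rewrite gtr0_norm//.
rewrite !powRN -invf_div lef_pV2 ?posrE ?divr_gt0 ?powR_gt0//.
rewrite ler_pdivrMr ?powR_gt0// -powRM ?(ltW v0)//.
by apply: ge0_ler_powR; rewrite ?nnegrE ?mulr_ge0 ?(ltW v0) ?(ltW u0) ?(ltW e0)//; lra.
Qed.

Lemma ler_subXX a u v k : `|u| <= a -> `|v| <= a ->
  `|u ^+ k - v ^+ k| <= k%:R * `|u - v| * a ^+ k.-1.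
Proof.
move=> ua va; rewrite subrXX normrM -mulrA [leRHS]mulrCA ler_wpM2l//.
apply: (le_trans (ler_norm_sum _ _ _)).
rewrite -[X in X%:R]card_ord mulr_natl -sumr_const; apply: ler_sum => i _.
rewrite normrM !normrX.
have -> : a ^+ k.-1 = a ^+ (k.-1 - i) * a ^+ i.
  by rewrite -exprD subnK//; case: k i => [[]//|k i]; rewrite -ltnS.
by apply: ler_pM; rewrite ?exprn_ge0// lerXn2r// nnegrE (le_trans _ ua).
Qed.

End powers.

Section commutator_kernel.
Context {R : realType} {n : nat}.
Variables (alpha eta delta : R) (K b : 'rV[R]_n -> R) (m : nat) (CK CH L : R).
Hypotheses (eta_gt0 : 0 < eta) (delta_gt0 : 0 < delta).
Hypotheses (CK_gt0 : 0 < CK) (CH_gt0 : 0 < CH) (L_ge0 : 0 <= L).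
Hypothesis Ksize : forall z, 0 < enorm z -> `|K z| <= CK * enorm z `^ (alpha - n%:R).
Hypothesis Ksmooth : forall x x' y : 'rV[R]_n,
  2 * enorm (x - x') <= enorm (x - y) ->
  `|K (x - y) - K (x' - y)| + `|K (y - x) - K (y - x')|
    <= CH * (enorm (x - x') `^ eta / enorm (x - y) `^ (n%:R - alpha + eta)).
Hypothesis blip : forall x y : 'rV[R]_n, `|b x - b y| <= L * enorm (x - y) `^ delta.

Let lipX x y : `|b x - b y| ^+ m <= L ^+ m * enorm (x - y) `^ (m%:R * delta).
Proof.
rewrite -powR_expr -exprMn lerXn2r ?nnegrE//.
by rewrite mulr_ge0 ?powR_ge0.
Qed.

Lemma comm_kernel_near x y :
  `|comm_kernel K b m x y| <= L ^+ m * enorm (x - y) `^ (m%:R * delta) * `|K (x - y)|.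
Proof. by rewrite normrM normrX ler_wpM2r. Qed.

(** The constants below are explicit because the final constant has to be chosen
    before [b] and [f]: they involve only the parameters and the kernel. *)
Definition far_const : R :=
  CH * 2 `^ eta * 2 `^ `|m%:R * delta - (n%:R - alpha + eta)| +
  m%:R * 2 `^ delta * 2 `^ `|delta| ^+ m.-1 * CK * 2 `^ `|alpha - n%:R|.

(** Splitting [(b x - b y)^m K (x - y) - (b x' - b y)^m K (x' - y)] puts the
    increment once on [K], where smoothness gains [|x - x'|^eta], and once on
    [b], where the Lipschitz condition gains [|x - x'|^delta]. The factor [5] keeps
    [y] far enough from [x] and [x'] for the smoothness condition to apply and for
    [|x - y|], [|x' - y|] and [|y - c|] to be comparable. *)
Lemma comm_kernel_far c rho x x' y : 0 < rho ->
  enorm (x - c) < rho -> enorm (x' - c) < rho -> 5 * rho <= enorm (y - c) ->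
  `|comm_kernel K b m x y - comm_kernel K b m x' y| <=
   far_const * L ^+ m *
    (rho `^ eta * enorm (y - c) `^ (- (n%:R - alpha + eta - m%:R * delta)) +
     rho `^ delta * enorm (y - c) `^ (- (n%:R - alpha - (m%:R - 1) * delta))).
Proof.
move=> rho0 xc x'c; set u := enorm (y - c) => yc.
have u0 : 0 < u by lra.
have near z : enorm (z - c) < rho -> u / 2 <= enorm (z - y) <= 2 * u /\ 4 * rho <= enorm (z - y).
  move=> zc; have h1 := ler_enormB y z c; rewrite (enormBC y z) -/u in h1.
  have h2 := ler_enormB z c y; rewrite (enormBC c y) -/u in h2.
  by split; [apply/andP; split|]; lra.
have [xy x4] := near _ xc; have [x'y x'4] := near _ x'c.
have v0 : 0 < enorm (x - y) by lra.
have v'0 : 0 < enorm (x' - y) by lra.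
have xx' : enorm (x - x') <= 2 * rho.
  by have := ler_enormB x c x'; rewrite (enormBC c x'); lra.
have -> : comm_kernel K b m x y - comm_kernel K b m x' y =
  (b x - b y) ^+ m * (K (x - y) - K (x' - y)) +
  ((b x - b y) ^+ m - (b x' - b y) ^+ m) * K (x' - y).
  by rewrite /comm_kernel; ring.
apply: (le_trans (ler_normD _ _)).
have Lm0 : 0 <= L ^+ m by rewrite exprn_ge0.
have first : `|(b x - b y) ^+ m * (K (x - y) - K (x' - y))| <=
   CH * 2 `^ eta * 2 `^ `|m%:R * delta - (n%:R - alpha + eta)| * L ^+ m *
     (rho `^ eta * u `^ (- (n%:R - alpha + eta - m%:R * delta))).
  rewrite normrM normrX.
  have sm : `|K (x - y) - K (x' - y)| <=
      CH * ((2 * rho) `^ eta / enorm (x - y) `^ (n%:R - alpha + eta)).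
    have xy2 : 2 * enorm (x - x') <= enorm (x - y) by lra.
    apply: le_trans (le_trans (Ksmooth xy2) _); first by rewrite lerDl.
    rewrite ler_wpM2l ?(ltW CH_gt0)// ler_wpM2r ?invr_ge0 ?powR_ge0//.
    apply: ge0_ler_powR; rewrite ?nnegrE ?(ltW eta_gt0) ?enorm_ge0//.
    by rewrite mulr_ge0// ltW.
  apply: (le_trans (ler_pM _ _ (lipX x y) sm)) => //.
  rewrite powRM ?(ltW rho0)//.
  have cmp := powR_comparable (m%:R * delta - (n%:R - alpha + eta)) u0 xy.
  have -> : - (n%:R - alpha + eta - m%:R * delta) =
     m%:R * delta - (n%:R - alpha + eta) by ring.
  rewrite powRB in cmp; last by rewrite (gt_eqF v0) implybT.
  have c0 : 0 <= L ^+ m * CH * 2 `^ eta * rho `^ eta.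
    by rewrite !mulr_ge0 ?powR_ge0// ltW.
  have := ler_wpM2l c0 cmp.
  by congr (_ <= _); ring.
have second : `|((b x - b y) ^+ m - (b x' - b y) ^+ m) * K (x' - y)| <=
   m%:R * 2 `^ delta * 2 `^ `|delta| ^+ m.-1 * CK * 2 `^ `|alpha - n%:R| *
     L ^+ m * (rho `^ delta * u `^ (- (n%:R - alpha - (m%:R - 1) * delta))).
  have [->|m0] := posnP m; first by rewrite !expr0 subrr !mul0r normr0.
  pose M := L * (2 `^ `|delta| * u `^ delta).
  have bM z : u / 2 <= enorm (z - y) <= 2 * u -> `|b z - b y| <= M.
    move=> zy; apply: (le_trans (blip z y)); rewrite ler_wpM2l//.
    exact: powR_comparable.
  have bxx' : `|b x - b x'| <= L * (2 * rho) `^ delta.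
    apply: (le_trans (blip x x')); rewrite ler_wpM2l//.
    apply: ge0_ler_powR; rewrite ?nnegrE ?(ltW delta_gt0) ?enorm_ge0//.
    by rewrite mulr_ge0// ltW.
  have M0 : 0 <= M by rewrite !mulr_ge0 ?powR_ge0.
  have d1 : `|(b x - b y) ^+ m - (b x' - b y) ^+ m| <=
      m%:R * (L * (2 * rho) `^ delta) * M ^+ m.-1.
    apply: (le_trans (ler_subXX m (bM _ xy) (bM _ x'y))).
    rewrite ler_wpM2r ?exprn_ge0// ler_wpM2l//.
    by have -> : b x - b y - (b x' - b y) = b x - b x' by ring.
  have d2 : `|K (x' - y)| <= CK * (2 `^ `|alpha - n%:R| * u `^ (alpha - n%:R)).
    apply: (le_trans (Ksize v'0)); rewrite ler_wpM2l ?(ltW CK_gt0)//.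
    exact: powR_comparable.
  rewrite normrM; apply: (le_trans (ler_pM _ _ d1 d2)) => //.
  rewrite /M !exprMn powRM ?(ltW rho0)// (powR_expr u).
  have -> : - (n%:R - alpha - (m%:R - 1) * delta) =
    (m.-1)%:R * delta + (alpha - n%:R).
    by rewrite -subn1 natrB//; ring.
  rewrite (@powRD _ u (m.-1%:R * delta)); last by rewrite (gt_eqF u0) implybT.
  have -> : L ^+ m = L * L ^+ m.-1 by rewrite -exprS prednK.
  by rewrite le_eqVlt; apply/orP; left; apply/eqP; ring.
have c10 : 0 <= CH * 2 `^ eta * 2 `^ `|m%:R * delta - (n%:R - alpha + eta)|.
  by rewrite !mulr_ge0 ?powR_ge0// ltW.
have c20 : 0 <= m%:R * 2 `^ delta * 2 `^ `|delta| ^+ m.-1 * CK * 2 `^ `|alpha - n%:R|.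
  by rewrite !mulr_ge0 ?exprn_ge0 ?powR_ge0// ltW.
apply: (le_trans (lerD first second)).
rewrite mulrDr; apply: lerD.
  rewrite ler_wpM2r ?mulr_ge0 ?powR_ge0// ler_wpM2r//.
  by rewrite /far_const lerDl.
rewrite ler_wpM2r ?mulr_ge0 ?powR_ge0// ler_wpM2r//.
by rewrite /far_const lerDr.
Qed.

End commutator_kernel.

(** * Measure-theoretic tools *)

Section open_sets.
Context {R : realType} {n : nat}.
Implicit Types (S : set 'rV[R]_n).

Let rball (k : nat) : set 'rV[R]_n :=
  if (unpickle k : option ('rV[rat]_n * nat)) is Some qj
  then eball (map_mx ratr qj.1) (qj.2.+1%:R^-1) else set0.

(** Rational vectors being dense, a set containing a ball around each of its
    points is a countable union of rational balls. *)
Lemma measurable_ball_neighbourhoods S :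
  (forall x, S x -> exists2 e : R, 0 < e & eball x e `<=` S) -> measurable S.
Proof.
move=> openS.
have -> : S = \bigcup_(k in [set k | rball k `<=` S]) rball k.
  apply/seteqP; split=> [x Sx|x [k /= kS] kx]; last exact: kS.
  have [e e0 eS] := openS _ Sx.
  pose j := Num.truncn (2 / e).
  have j0 : 0 < (j.+1%:R^-1 : R) by rewrite invr_gt0 ltr0n.
  have je : 2 * j.+1%:R^-1 < e.
    by rewrite ltr_pdivrMr ?ltr0n// mulrC -ltr_pdivrMr// truncnS_gt.
  have [n0|n0] := posnP n.
    exists (pickle ((0 : 'rV[rat]_n), j)) => /=.
    - rewrite /rball pickleK /= => y _; apply: eS.
      rewrite /eball /= (_ : y - x = 0) ?enorm0//.
      by apply/rowP => -[i ilt]; exfalso; move: ilt; rewrite n0.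
    - rewrite /rball pickleK /eball/= (_ : x - _ = 0) ?enorm0//.
      by apply/rowP => -[i ilt]; exfalso; move: ilt; rewrite n0.
  pose d : R := j.+1%:R^-1 / n%:R.
  have d0 : 0 < d by rewrite divr_gt0// ltr0n.
  have qex i : exists q : rat, x ord0 i - d < ratr q < x ord0 i + d.
    have [|q] := @rat_in_itvoo R (x ord0 i - d) (x ord0 i + d); first lra.
    by rewrite in_itv/=; exists q.
  pose q : 'rV[rat]_n := \row_i xchoose (qex i).
  have xq : enorm (x - map_mx ratr q) < j.+1%:R^-1.
    apply: (cube_sub_eball n0) => i /=.
    rewrite in_itv/= !mxE -/d.
    by have /andP[h1 h2] := xchooseP (qex i); apply/andP; split; lra.
  exists (pickle (q, j)); rewrite /= /rball pickleK//=.
  move=> y yq; apply: eS.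
  have yq' : enorm (y - map_mx ratr q) < j.+1%:R^-1 by exact: yq.
  apply: (le_lt_trans (ler_enormB y (map_mx ratr q) x)).
  rewrite (enormBC (map_mx ratr q) x); apply: (lt_trans (ltrD yq' xq)).
  by rewrite -mulr2n -[ltLHS]mulr_natl.
apply: bigcup_measurable => k _; rewrite /rball.
by case: (unpickle k) => [qj|]; [exact: measurable_eball|exact: measurable0].
Qed.

(** The measurable structure on vectors is generated by the coordinates, so the
    measurability of a continuous function goes through the countable union of
    rational balls above. *)
Lemma measurable_lipschitz (b : 'rV[R]_n -> R) (L delta : R) :
  0 <= L -> 0 < delta ->
  (forall x y, `|b x - b y| <= L * enorm (x - y) `^ delta) ->
  measurable_fun setT b.
Proof.
move=> L0 delta0 blip; apply: (measurability _ (RGenOInfty.measurableE R)).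
move=> _ [_ [a ->] <-]; rewrite setTI.
apply: measurable_ball_neighbourhoods => x; rewrite /= in_itv/= andbT => ax.
pose e := ((b x - a) / (L + 1)) `^ delta^-1.
have bxa : 0 < (b x - a) / (L + 1) by rewrite divr_gt0 ?subr_gt0//; lra.
have e0 : 0 < e by rewrite powR_gt0.
(* The radius [e] is such that [L e^delta] stays below [b x - a]. *)
exists e => // y; rewrite /eball/= in_itv/= andbT => ye.
have h : enorm (y - x) `^ delta <= (b x - a) / (L + 1).
  have -> : (b x - a) / (L + 1) = e `^ delta.
    by rewrite -powRrM mulVf ?gt_eqF// powRr1// ltW.
  by apply: ge0_ler_powR; rewrite ?nnegrE ?enorm_ge0 ?(ltW delta0) ?(ltW e0) ?(ltW ye).
have h2 : `|b y - b x| < b x - a.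
  apply: (le_lt_trans (blip y x)).
  apply: (@le_lt_trans _ _ (L * ((b x - a) / (L + 1)))); first exact: ler_wpM2l.
  rewrite mulrA ltr_pdivrMr; last by lra.
  by rewrite mulrC ltr_pM2l ?subr_gt0//; lra.
by have := ler_norm (b x - b y); rewrite distrC; lra.
Qed.

End open_sets.

Section convolution.
Local Open Scope ereal_scope.
Context {R : realType} {n : nat}.
Variables phi psi : 'rV[R]_n -> \bar R.
Hypotheses (mphi : measurable_fun setT phi) (mpsi : measurable_fun setT psi).
Hypotheses (phi0 : forall x, 0 <= phi x) (psi0 : forall x, 0 <= psi x).

Definition convolution (x : 'rV[R]_n) := \int[leb n]_y (phi y * psi (x - y)%R).

Let measurable_conv : measurable_fun setT
  (fun z : 'rV[R]_n * 'rV[R]_n => phi z.2 * psi (z.1 - z.2)%R).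
Proof.
apply: emeasurable_funM; first exact: (measurableT_comp mphi measurable_snd).
apply: (measurableT_comp mpsi).
by apply: measurable_funB_rV; [exact: measurable_fst|exact: measurable_snd].
Qed.

Let conv_ge0 (z : 'rV[R]_n * 'rV[R]_n) : 0 <= phi z.2 * psi (z.1 - z.2)%R.
Proof. exact: mule_ge0. Qed.

Lemma measurable_convolution : measurable_fun setT convolution.
Proof. exact: (measurable_fun_fubini_tonelli_F _ measurable_conv conv_ge0). Qed.

Lemma convolution_ge0 x : 0 <= convolution x.
Proof. by apply: integral_ge0 => y _; exact: mule_ge0. Qed.

Lemma integral_convolution :
  \int[leb n]_x convolution x = \int[leb n]_y phi y * \int[leb n]_z psi z.
Proof.
rewrite /convolution (fubini_tonelli _ measurable_conv conv_ge0)/=.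
rewrite -ge0_integralZr//; last exact: integral_ge0.
apply: eq_integral => y _; rewrite ge0_integralZl//.
  by rewrite ge0_integral_leb_shift.
apply: (measurableT_comp mpsi).
exact: measurable_funB_rV.
Qed.

End convolution.

Section mean_oscillation.
Context {R : realType} {n : nat}.
Local Notation mu := (leb n : {measure set 'rV[R]_n -> \bar R}).

Lemma integrable_cst_eball (c : 'rV[R]_n) (k rho : R) : 0 < rho ->
  mu.-integrable (eball c rho) (EFin \o cst k).
Proof.
move=> rho0; have mB : measurable (eball c rho) := measurable_eball c rho.
have muB : mu (eball c rho) = (vol (eball c rho))%:E := leb_eballE c rho0.
apply/integrableP; split; first exact/measurable_EFinP/measurable_cst.
by rewrite /= integral_cst// muB -EFinM ltry.
Qed.

(** Replacing the mean by an arbitrary constant costs a factor [2]. *)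
Lemma mean_oscillation_le (c : 'rV[R]_n) (rho a : R) (g : 'rV[R]_n -> R) :
  (0 < n)%N -> 0 < rho ->
  mu.-integrable (eball c rho) (EFin \o g) ->
  (\int[mu]_(x in eball c rho) `|g x - average g (eball c rho)|%:E
    <= 2%:E * \int[mu]_(x in eball c rho) `|g x - a|%:E)%E.
Proof.
move=> n0 rho0; set B := eball c rho => ig.
have mB : measurable B := measurable_eball c rho.
have V0 : 0 < vol B := vol_gt0 c n0 rho0.
have muB : mu B = (vol B)%:E := leb_eballE c rho0.
have icst (k : R) := integrable_cst_eball c k rho0.
have iB (k : R) : mu.-integrable B (EFin \o (fun x => g x - k)).
  by have := integrableB mB ig (icst k); apply: eq_integrable.
have iN (k : R) : mu.-integrable B (EFin \o (fun x => `|g x - k|)).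
  exact: integrable_norm (iB k).
have E (k : R) : (\int[mu]_(x in B) `|g x - k|%:E)%E = (\int[mu]_(x in B) `|g x - k|)%:E.
  by rewrite fineK//; exact: integrable_fin_num (iN k).
have Rcst (k : R) : \int[mu]_(x in B) k = k * vol B by exact: Rintegral_cst.
rewrite !E -EFinM lee_fin.
set I := \int[mu]_(x in B) `|g x - a|.
have avg : `|average g B - a| * vol B <= I.
  have -> : `|average g B - a| * vol B = `|\int[mu]_(x in B) (g x - a)|.
    rewrite (RintegralB mB ig (icst a)) Rcst -{1}(gtr0_norm V0) -normrM mulrBl.
    by rewrite /average mulrAC mulVf ?mul1r// gt_eqF.
  exact: le_normr_Rintegral.
apply: (@le_trans _ _ (\int[mu]_(x in B) (`|g x - a| + `|average g B - a|))).
  apply: le_Rintegral => //.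
    have := integrableD mB (iN a) (icst `|average g B - a|).
    by apply: eq_integrable.
  move=> x _; have := ler_normD (g x - a) (a - average g B).
  by rewrite addrA subrK (distrC a).
rewrite (RintegralD mB (iN a) (icst _)).
by rewrite Rcst mulr_natl mulr2n lerD2l.
Qed.

End mean_oscillation.

Lemma measurable_Rintegral_parameter (R : realType) (n : nat)
    (F : 'rV[R]_n -> 'rV[R]_n -> R) :
  measurable_fun setT (fun z : 'rV[R]_n * 'rV[R]_n => F z.1 z.2) ->
  measurable_fun setT (fun x => \int[leb n]_y F x y).
Proof.
move=> mF; pose G (z : 'rV[R]_n * 'rV[R]_n) := (F z.1 z.2)%:E.
have mG : measurable_fun setT G by exact/measurable_EFinP.
have mI : measurable_fun setT (fun x => \int[leb n]_y (F x y)%:E)%E.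
  under eq_fun => x do rewrite integralE.
  have pos := @measurable_fun_fubini_tonelli_F _ _ _ _ R (leb n) (G ^\+)%E
    (measurable_funepos mG) (funepos_ge0 G).
  have neg := @measurable_fun_fubini_tonelli_F _ _ _ _ R (leb n) (G ^\-)%E
    (measurable_funeneg mG) (funeneg_ge0 G).
  apply: emeasurable_funB.
    apply: eq_measurable_fun pos => x _.
    by apply: eq_integral => y _; rewrite !funeposE.
  apply: eq_measurable_fun neg => x _.
  by apply: eq_integral => y _; rewrite !funenegE.
exact: (measurableT_comp (fine_measurable measurableT) mI).
Qed.

(** * Local and far parts of the commutator *)

Section commutator_parts.
Local Open Scope ereal_scope.
Context {R : realType} {n : nat}.
Local Notation mu := (leb n : {measure set 'rV[R]_n -> \bar R}).
Variables (alpha eta delta sigma : R) (K b f : 'rV[R]_n -> R) (m : nat).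
Variables (CK CH CI L : R).
Hypotheses (n_gt0 : (0 < n)%N) (alpha_gt0 : (0 < alpha)%R).
Hypotheses (eta_gt0 : (0 < eta)%R) (delta_gt0 : (0 < delta)%R).
Hypothesis order_lt : (m%:R * delta + alpha < n%:R)%R.
Hypotheses (sigma_ge0 : (0 <= sigma)%R).
Hypotheses (sigma_delta : (sigma < delta)%R) (sigma_eta : (sigma < eta)%R).
Hypotheses (CK_gt0 : (0 < CK)%R) (CH_gt0 : (0 < CH)%R) (CI_gt0 : (0 < CI)%R).
Hypotheses (mK : measurable_fun setT K) (mf : measurable_fun setT f).
Hypothesis Ksize : forall z, (0 < enorm z)%R ->
  (`|K z| <= CK * enorm z `^ (alpha - n%:R))%R.
Hypothesis Ksmooth : forall x x' y : 'rV[R]_n,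
  (2 * enorm (x - x') <= enorm (x - y))%R ->
  (`|K (x - y) - K (x' - y)| + `|K (y - x) - K (y - x')|
    <= CH * (enorm (x - x') `^ eta / enorm (x - y) `^ (n%:R - alpha + eta)))%R.
Hypothesis Kint : forall s : R, (0 < s)%R ->
  \int[mu]_(x in eball 0%R s) `|K x|%:E <= (CI * s `^ alpha)%:E.
Hypothesis L_ge0 : (0 <= L)%R.
Hypothesis blip : forall x y : 'rV[R]_n,
  (`|b x - b y| <= L * enorm (x - y)%R `^ delta)%R.

(** For [f] in [L^r_w] this is [n - n / r]; it is written in terms of the target
    order [sigma = m delta + alpha - n / r]. *)
Definition growth_exponent : R := (n%:R - alpha - m%:R * delta + sigma)%R.
Local Notation p := growth_exponent.

(** Apart from measurability, the only property of [f] on which the estimates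
    depend; the weight is hidden in [A]. *)
Definition ball_growth (c : 'rV[R]_n) (rho A : R) :=
  forall t : R, (rho <= t)%R ->
    \int[mu]_(y in eball c t) `|f y|%:E <= (A * t `^ p)%:E.

Lemma measurable_comm_kernel : measurable_fun setT
  (fun z : 'rV[R]_n * 'rV[R]_n => comm_kernel K b m z.1 z.2).
Proof.
have mb := measurable_lipschitz L_ge0 delta_gt0 blip.
apply: measurable_funM.
  apply: measurable_funX; apply: measurable_funB.
    exact: (measurableT_comp mb measurable_fst).
  exact: (measurableT_comp mb measurable_snd).
apply: (measurableT_comp mK).
by apply: measurable_funB_rV; [exact: measurable_fst|exact: measurable_snd].
Qed.

Lemma measurable_comm_kernel1 x : measurable_fun setT (comm_kernel K b m x).
Proof. exact: (measurableT_comp measurable_comm_kernel (measurable_pair1 x)). Qed.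

(** A majorant, up to a factor, of the local part of the commutator: if [|x - c|]
    is below [rho] and [|y - c|] below [5 rho], then [|x - y|] is below [6 rho], so
    that cutting off [f] and [K] separately loses nothing and leaves a
    convolution. *)
Definition local_potential (c : 'rV[R]_n) (rho : R) : 'rV[R]_n -> \bar R :=
  convolution (fun y => (`|f y| * \1_(eball c (5 * rho)%R) y)%:E)
              (fun z => (`|K z| * \1_(eball (0 : 'rV[R]_n) (6 * rho)%R) z)%:E).

Let mphi c (rho : R) :
  measurable_fun setT (fun y => (`|f y| * \1_(eball c (5 * rho)%R) y)%:E).
Proof.
apply/measurable_EFinP; apply: measurable_funM; first exact: measurableT_comp.
by apply: measurable_indic; exact: measurable_eball.
Qed.

Let mpsi (rho : R) : measurable_fun setT
  (fun z => (`|K z| * \1_(eball (0 : 'rV[R]_n) (6 * rho)%R) z)%:E).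
Proof.
apply/measurable_EFinP; apply: measurable_funM; first exact: measurableT_comp.
by apply: measurable_indic; exact: measurable_eball.
Qed.

Lemma measurable_local_potential c rho : measurable_fun setT (local_potential c rho).
Proof. exact: measurable_convolution. Qed.

Lemma local_potential_ge0 c rho x : 0 <= local_potential c rho x.
Proof. exact: convolution_ge0. Qed.

(** A convolution of two nonnegative functions has the product of their integrals
    as integral, and both factors are controlled on balls. *)
Lemma integral_local_potential c (rho A : R) : (0 < rho)%R -> (0 <= A)%R ->
  ball_growth c rho A ->
  \int[mu]_(x in eball c rho) local_potential c rho x <=
    (A * (5 * rho) `^ p * (CI * (6 * rho) `^ alpha))%:E.
Proof.
move=> rho0 A0 Agrow.
apply: (@le_trans _ _ (\int[mu]_x local_potential c rho x)).
  apply: ge0_subset_integral => //.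
  - exact: measurable_eball.
  - exact: measurable_funS (measurable_local_potential c rho).
  - by move=> x _; exact: local_potential_ge0.
have -> : \int[mu]_x local_potential c rho x =
    \int[mu]_y (`|f y| * \1_(eball c (5 * rho)%R) y)%:E *
    \int[mu]_z (`|K z| * \1_(eball (0 : 'rV[R]_n) (6 * rho)%R) z)%:E.
  exact: integral_convolution.
rewrite -!integral_eball_indic EFinM.
apply: lee_pmul; [exact: integral_ge0|exact: integral_ge0| |].
  by apply: Agrow; lra.
by apply: Kint; lra.
Qed.

Lemma local_part_le c (rho : R) x : (0 < rho)%R -> eball c rho x ->
  \int[mu]_(y in eball c (5 * rho)%R) `|comm_kernel K b m x y * f y|%:E
  <= (L ^+ m * (6 * rho) `^ (m%:R * delta))%:E * local_potential c rho x.
Proof.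
move=> rho0 xc; pose F y := (`|f y| * \1_(eball c (5 * rho)%R) y)%:E *
  (`|K (x - y)| * \1_(eball (0 : 'rV[R]_n) (6 * rho)%R) (x - y)%R)%:E.
have mF : measurable_fun setT F.
  apply: emeasurable_funM => //; apply: (measurableT_comp (mpsi rho)).
  exact: measurable_funB_rV.
have F0 y : 0 <= F y by rewrite mule_ge0// lee_fin mulr_ge0.
have k0 : 0 <= (L ^+ m * (6 * rho) `^ (m%:R * delta))%:E.
  by rewrite lee_fin mulr_ge0 ?exprn_ge0 ?powR_ge0.
have -> : local_potential c rho x = \int[mu]_y F y by [].
rewrite -ge0_integralZl// integral_eball_indic; apply: ge0_le_integral => //.
- apply/measurable_EFinP; apply: measurable_funM; last first.
    by apply: measurable_indic; exact: measurable_eball.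
  apply: measurableT_comp => //; apply: measurable_funM => //.
  exact: measurable_comm_kernel1.
- exact: emeasurable_funM.
move=> y _; rewrite /F -!EFinM lee_fin !indicE.
have [yc|_] := boolP (y \in eball c (5 * rho)); last first.
  by rewrite !mulr0 mul0r mulr0.
have xy : (enorm (x - y) < 6 * rho)%R.
  have := ler_enormB x c y; rewrite (enormBC c y).
  by move: xc yc; rewrite inE /eball/= => h1 h2; lra.
rewrite mem_set; last by rewrite /eball/= subr0.
rewrite !mulr1 normrM [leRHS]mulrCA [leLHS]mulrC ler_wpM2l//.
apply: (le_trans (comm_kernel_near _ _ L_ge0 blip _ _)).
rewrite ler_wpM2r// ler_wpM2l ?exprn_ge0//.
have md0 : (0 <= m%:R * delta)%R by rewrite mulr_ge0// ltW.
by apply: ge0_ler_powR; rewrite ?nnegrE ?enorm_ge0 ?(ltW xy)//; lra.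
Qed.

Let s1 : R := (n%:R - alpha + eta - m%:R * delta)%R.
Let s2 : R := (n%:R - alpha - (m%:R - 1) * delta)%R.

Definition far_total : R :=
  (@far_const R n alpha eta delta m CK CH *
   (2 `^ p / (1 - 2 `^ (sigma - eta)) * 5 `^ (sigma - eta) +
    2 `^ p / (1 - 2 `^ (sigma - delta)) * 5 `^ (sigma - delta)))%R.

Lemma far_const_ge0 : (0 <= @far_const R n alpha eta delta m CK CH)%R.
Proof.
by rewrite /far_const addr_ge0// !mulr_ge0 ?exprn_ge0 ?powR_ge0// ltW.
Qed.

Lemma setC_eball c (rho : R) :
  ~` eball c rho = [set y : 'rV[R]_n | (rho <= enorm (y - c))%R].
Proof. by apply/seteqP; split => y /=; rewrite /eball/= leNgt => /negP. Qed.

Let far_term c (rho A s tau : R) : (0 < rho)%R -> (0 <= A)%R ->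
  ball_growth c rho A -> (0 < s)%R -> (p - s = sigma - tau)%R -> (sigma < tau)%R ->
  \int[mu]_(y in ~` eball c (5 * rho)%R)
     ((rho `^ tau)%:E * (`|f y|%:E * (enorm (y - c)%R `^ (- s))%:E))
  <= (2 `^ p / (1 - 2 `^ (sigma - tau)) * 5 `^ (sigma - tau) * (A * rho `^ sigma))%:E.
Proof.
move=> rho0 A0 Agrow s0 ps st.
have mfa : measurable_fun setT (fun y => `|f y|%:E).
  by apply/measurable_EFinP; exact: measurableT_comp.
pose G y := `|f y|%:E * (enorm (y - c)%R `^ (- s))%:E.
have G0 y : 0 <= G y by apply: mule_ge0; rewrite lee_fin// powR_ge0.
have mG D : measurable_fun D G.
  apply: measurable_funTS; apply: emeasurable_funM => //; apply/measurable_EFinP.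
  exact: (measurableT_comp (measurable_powR _) (measurable_enormB c)).
have mB : measurable (~` eball c (5 * rho)%R).
  by apply: measurableC; exact: measurable_eball.
have r0 : 0 <= (rho `^ tau)%:E by rewrite lee_fin powR_ge0.
rewrite (@ge0_integralZl _ _ _ mu _ mB G (mG _) _ (fun y _ => G0 y) r0).
rewrite setC_eball.
have rho50 : (0 < 5 * rho)%R by lra.
have ps0 : (p < s)%R by lra.
have := @integral_far_le R n (fun y => `|f y|%:E) c A p s (5 * rho) A0 s0 ps0 rho50 mfa.
move=> /(_ (fun=> _)) H.
apply: (le_trans (lee_wpmul2l r0 (H _ _))).
- by move=> y; rewrite lee_fin.
- by move=> t rt; apply: Agrow; lra.
rewrite -EFinM lee_fin ps powRM ?(ltW rho0)//.
have -> : (rho `^ sigma = rho `^ tau * rho `^ (sigma - tau))%R.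
  rewrite -powRD; last by rewrite (gt_eqF rho0) implybT.
  by congr powR; ring.
by rewrite le_eqVlt; apply/orP; left; apply/eqP; ring.
Qed.

Lemma far_part_le c (rho A : R) x x' : (0 < rho)%R -> (0 <= A)%R ->
  ball_growth c rho A -> eball c rho x -> eball c rho x' ->
  \int[mu]_(y in ~` eball c (5 * rho)%R)
     `|(comm_kernel K b m x y - comm_kernel K b m x' y) * f y|%:E
  <= (far_total * L ^+ m * A * rho `^ sigma)%:E.
Proof.
move=> rho0 A0 Agrow xc x'c.
pose F (tau s : R) y := (rho `^ tau)%:E * (`|f y|%:E * (enorm (y - c)%R `^ (- s))%:E).
have F0 tau s y : 0 <= F tau s y.
  by apply: mule_ge0; [|apply: mule_ge0]; rewrite lee_fin// powR_ge0.
have mfa : measurable_fun setT (fun y => `|f y|%:E).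
  by apply/measurable_EFinP; exact: measurableT_comp.
have mF tau s : measurable_fun setT (F tau s).
  apply: emeasurable_funM => //; apply: emeasurable_funM => //.
  apply/measurable_EFinP.
  exact: (measurableT_comp (measurable_powR _) (measurable_enormB c)).
have mB : measurable (~` eball c (5 * rho)%R).
  by apply: measurableC; exact: measurable_eball.
pose C : R := (@far_const R n alpha eta delta m CK CH * L ^+ m)%R.
have C0 : 0 <= C%:E by rewrite lee_fin mulr_ge0 ?far_const_ge0 ?exprn_ge0.
apply: (@le_trans _ _ (\int[mu]_(y in ~` eball c (5 * rho)%R)
   (C%:E * (F eta s1 y + F delta s2 y)))).
  apply: ge0_le_integral => //.
  - apply/measurable_EFinP; apply: measurable_funTS; apply: measurableT_comp => //.
    apply: measurable_funM => //; apply: measurable_funB;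
    exact: measurable_comm_kernel1.
  - apply: measurable_funTS; apply: emeasurable_funM => //.
    exact: emeasurable_funD.
  move=> y; rewrite setC_eball/= => yc.
  rewrite /F -!EFinM lee_fin normrM.
  apply: (le_trans (ler_wpM2r (normr_ge0 (f y)) (comm_kernel_far m eta_gt0 delta_gt0
    CK_gt0 CH_gt0 L_ge0 Ksize Ksmooth blip rho0 xc x'c yc))).
  by rewrite -/s1 -/s2 -/C le_eqVlt; apply/orP; left; apply/eqP; ring.
have mFD tau s D : measurable_fun D (F tau s) by exact: measurable_funTS.
rewrite (@ge0_integralZl _ _ _ mu _ mB _ (emeasurable_funD (mFD eta s1 _) (mFD delta s2 _))
  _ (fun y _ => adde_ge0 (F0 _ _ y) (F0 _ _ y)) C0).
rewrite ge0_integralD//.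
have md : (0 <= m%:R * delta)%R by rewrite mulr_ge0// ltW.
have nma : (0 < n%:R - (m%:R * delta + alpha))%R by rewrite subr_gt0.
have H1 : (0 < s1)%R.
  have -> : (s1 = n%:R - (m%:R * delta + alpha) + eta)%R by rewrite /s1; ring.
  exact: addr_gt0.
have H2 : (0 < s2)%R.
  have -> : (s2 = n%:R - (m%:R * delta + alpha) + delta)%R by rewrite /s2; ring.
  exact: addr_gt0.
have e1 : (p - s1 = sigma - eta)%R by rewrite /growth_exponent /s1; ring.
have e2 : (p - s2 = sigma - delta)%R by rewrite /growth_exponent /s2; ring.
apply: (le_trans (lee_wpmul2l C0 (leeD
  (far_term rho0 A0 Agrow H1 e1 sigma_eta) (far_term rho0 A0 Agrow H2 e2 sigma_delta)))).
rewrite -EFinD -EFinM lee_fin /C /far_total.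
by rewrite le_eqVlt; apply/orP; left; apply/eqP; ring.
Qed.

(** Absolute convergence of the local part at every scale. Balls about the origin
    of integer radius suffice, and make the condition a countable one, so that it
    holds almost everywhere. *)
Definition good_point (x : 'rV[R]_n) := forall N : nat, (enorm x < N.+1%:R)%R ->
  \int[mu]_(y in eball (0 : 'rV[R]_n) (5 * N.+1%:R)%R)
    `|comm_kernel K b m x y * f y|%:E < +oo.

Hypothesis fgrow : forall c (rho : R), (0 < rho)%R ->
  exists2 A : R, (0 <= A)%R & ball_growth c rho A.

Let measurable_kf D x : measurable_fun D (fun y => comm_kernel K b m x y * f y)%R.
Proof.
by apply: measurable_funTS; apply: measurable_funM => //;
  exact: measurable_comm_kernel1.
Qed.

Let measurable_dkf D x x' : measurable_fun D
  (fun y => (comm_kernel K b m x y - comm_kernel K b m x' y) * f y)%R.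
Proof.
apply: measurable_funTS; apply: measurable_funM => //.
by apply: measurable_funB; exact: measurable_comm_kernel1.
Qed.

Lemma ae_local_potential_fin c (rho : R) : (0 < rho)%R ->
  {ae mu, forall x, eball c rho x -> local_potential c rho x < +oo}.
Proof.
move=> rho0; have [A A0 Agrow] := fgrow c rho0.
have ip : mu.-integrable (eball c rho) (local_potential c rho).
  apply/integrableP; split; first exact: measurable_funS (measurable_local_potential c rho).
  under eq_integral => x _ do rewrite gee0_abs ?local_potential_ge0//.
  exact: le_lt_trans (integral_local_potential rho0 A0 Agrow) (ltry _).
have := integrable_ae (measurable_eball c rho) ip.
apply: filterS => x H xc; have := H xc.
by rewrite ge0_fin_numE// local_potential_ge0.
Qed.

Lemma ae_good_point : {ae mu, forall x, good_point x}.
Proof.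
apply: ae_foralln => N.
have N0 : (0 < N.+1%:R :> R)%R by rewrite ltr0n.
have := @ae_local_potential_fin 0%R _ N0.
apply: filterS => x H xN.
have xc : eball (0 : 'rV[R]_n) N.+1%:R x by rewrite /eball/= subr0.
apply: (le_lt_trans (local_part_le N0 xc)).
have Hx := H xc; rewrite -ge0_fin_numE ?local_potential_ge0// in Hx.
by rewrite -(fineK Hx) -EFinM ltry.
Qed.

Let big_radius (x c : 'rV[R]_n) (rho : R) : exists N : nat,
  [/\ enorm x < N.+1%:R, enorm c < N.+1%:R & enorm c + rho < 5 * N.+1%:R :> R]%R.
Proof.
exists (Num.truncn (enorm x + enorm c + `|rho|)%R).
have := truncnS_gt (enorm x + enorm c + `|rho|)%R.
set M := (_.+1%:R)%R => H.
have := enorm_ge0 x; have := enorm_ge0 c; have := ler_norm rho.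
have := normr_ge0 rho => h1 h2 h3 h4.
by split; lra.
Qed.

Lemma good_point_ball x c (rho : R) : good_point x ->
  mu.-integrable (eball c rho) (EFin \o (fun y => comm_kernel K b m x y * f y)%R).
Proof.
move=> gx; have [N [xN _ cN]] := big_radius x c rho.
apply: (@integrableS _ _ _ mu (eball (0 : 'rV[R]_n) (5 * N.+1%:R)%R)).
- exact: measurable_eball.
- exact: measurable_eball.
- move=> y; rewrite /eball/= subr0 => yc.
  by have := ler_enormB y c 0%R; rewrite !subr0; lra.
apply/integrableP; split; first exact/measurable_EFinP.
by have := gx N xN.
Qed.

Let split_ball c (rho : R) (h : 'rV[R]_n -> \bar R) :
  measurable_fun setT h -> (forall y, 0 <= h y) ->
  \int[mu]_y h y = \int[mu]_(y in eball c rho) h y + \int[mu]_(y in ~` eball c rho) h y.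
Proof.
move=> mh h0; have mB := measurable_eball c rho.
rewrite -{1}(setUv (eball c rho)) ge0_integral_setU//.
- exact: measurableC.
- exact: measurable_funS mh.
- by rewrite disj_set2E setICr.
Qed.

(** Near the two points each kernel is integrable against [f]; away from them only
    their difference is. *)
Lemma good_pair_integrable x x' : good_point x -> good_point x' ->
  mu.-integrable setT (EFin \o
    (fun y => (comm_kernel K b m x y - comm_kernel K b m x' y) * f y)%R).
Proof.
move=> gx gx'; have [N [xN x'N _]] := big_radius x x' 0%R.
have N0 : (0 < N.+1%:R :> R)%R by rewrite ltr0n.
have xc : eball (0 : 'rV[R]_n) N.+1%:R x by rewrite /eball/= subr0.
have x'c : eball (0 : 'rV[R]_n) N.+1%:R x' by rewrite /eball/= subr0.
have [A A0 Agrow] := fgrow 0%R N0.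
apply/integrableP; split; first exact/measurable_EFinP.
rewrite (split_ball 0%R (5 * N.+1%:R)%R); last 2 first.
- by do 2 apply: measurableT_comp => //; exact: measurable_dkf.
- by move=> y; rewrite lee_fin.
apply: lte_add_pinfty; last first.
  exact: le_lt_trans (far_part_le N0 A0 Agrow xc x'c) (ltry _).
have mB := measurable_eball (0 : 'rV[R]_n) (5 * N.+1%:R)%R.
have := integrableB mB (good_point_ball 0%R (5 * N.+1%:R)%R gx)
  (good_point_ball 0%R (5 * N.+1%:R)%R gx').
move=> /integrableP[_]; congr (_ < _); apply: eq_integral => y _ /=.
by rewrite mulrBl.
Qed.

Lemma ae_ball_witness (P : 'rV[R]_n -> Prop) c (rho : R) : (0 < rho)%R ->
  {ae mu, forall x, P x} -> exists2 x, eball c rho x & P x.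
Proof.
move=> rho0 [N [mN N0 PN]]; apply: contrapT => noP.
have BN : eball c rho `<=` N.
  by move=> x xc; apply: PN => Px; apply: noP; exists x.
have : mu (eball c rho) <= mu N.
  by apply: le_measure; rewrite ?inE//; exact: measurable_eball.
have muB : mu (eball c rho) = (vol (eball c rho))%:E := leb_eballE c rho0.
by rewrite N0 muB lee_fin leNgt vol_gt0.
Qed.

(** Fixing a good point [x0] and subtracting from [g x0] the local part of the
    integral at [x0] leaves a constant [a] for which [g x - a] is the local part
    at [x] minus the far part of the kernel difference. *)
Lemma commutator_minus_const c (rho A : R) g : (0 < rho)%R -> (0 <= A)%R ->
  ball_growth c rho A -> is_commutator K b m f g ->
  exists a : R, {ae mu, forall x, eball c rho x ->
    `|g x - a|%:E <=
      (L ^+ m * (6 * rho) `^ (m%:R * delta))%:E * local_potential c rho x +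
      (far_total * L ^+ m * A * rho `^ sigma)%:E}.
Proof.
move=> rho0 A0 Agrow [mg Hg].
have [x0 x0c [gx0 Hx0]] := ae_ball_witness c rho0 (filterI ae_good_point Hg).
pose B := eball c (5 * rho)%R.
have mB : measurable B := measurable_eball _ _.
have mBC : measurable (~` B) by exact: measurableC.
pose kf x y := (comm_kernel K b m x y * f y)%R.
exists (g x0 - \int[mu]_(y in B) kf x0 y)%R.
apply: filterS2 ae_good_point Hx0 => x gx [id eq] xc.
set d := fun y => ((comm_kernel K b m x0 y - comm_kernel K b m x y) * f y)%R in id eq.
have ikx := good_point_ball c (5 * rho)%R gx.
have ikx0 := good_point_ball c (5 * rho)%R gx0.
have idC : mu.-integrable (~` B) (EFin \o d).
  exact: integrableS id.
have split : (\int[mu]_y d y = (\int[mu]_(y in B) kf x0 y - \int[mu]_(y in B) kf x y)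
    + \int[mu]_(y in ~` B) d y)%R.
  rewrite -(RintegralB mB ikx0 ikx) -{1}(setUv B) Rintegral_setU//.
  - by congr (_ + _)%R; apply: eq_Rintegral => y _; rewrite /d mulrBl.
  - by rewrite setUv.
  - by rewrite disj_set2E setICr.
have -> : (g x - (g x0 - \int[mu]_(y in B) kf x0 y) =
   \int[mu]_(y in B) kf x y - \int[mu]_(y in ~` B) d y)%R.
  by have := eq; rewrite split; lra.
apply: (@le_trans _ _ (`|\int[mu]_(y in B) kf x y|%:E + `|\int[mu]_(y in ~` B) d y|%:E)).
  by rewrite -EFinD lee_fin ler_normB.
rewrite (EFin_normr_Rintegral mB ikx) (EFin_normr_Rintegral mBC idC).
apply: leeD.
  apply: (le_trans _ (local_part_le rho0 xc)).
  exact: le_abse_integral (measurable_int _ ikx).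
apply: (le_trans _ (far_part_le rho0 A0 Agrow x0c xc)).
exact: le_abse_integral (measurable_int _ idC).
Qed.

Definition oscillation_const : R :=
  (2 * (6 `^ (m%:R * delta) * 5 `^ p * CI * 6 `^ alpha + far_total * 2 ^+ n))%R.

Lemma commutator_oscillation c (rho A : R) g : (0 < rho)%R -> (0 <= A)%R ->
  ball_growth c rho A -> is_commutator K b m f g ->
  mu.-integrable (eball c rho) (EFin \o g) /\
  \int[mu]_(x in eball c rho) `|g x - average g (eball c rho)|%:E <=
    (oscillation_const * L ^+ m * A * rho `^ (n%:R + sigma))%:E.
Proof.
move=> rho0 A0 Agrow Cg; have [mg _] := Cg.
have [a Ha] := commutator_minus_const rho0 A0 Agrow Cg.
set B := eball c rho in Ha *.
have mB : measurable B := measurable_eball _ _.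
set k := (L ^+ m * _)%:E in Ha; set D := (far_total * _ * _ * _)%:E in Ha.
have k0 : 0 <= k by rewrite lee_fin mulr_ge0 ?exprn_ge0 ?powR_ge0.
have mga D' : measurable_fun D' (fun x => `|g x - a|%:E).
  apply: measurable_funTS; apply/measurable_EFinP; apply: measurableT_comp => //.
  exact: measurable_funB.
have mpot D' : measurable_fun D' (local_potential c rho).
  by apply: measurable_funTS; exact: measurable_local_potential.
have far0 : (0 <= far_total)%R.
  rewrite /far_total mulr_ge0 ?far_const_ge0//.
  have geo tau : (sigma < tau)%R ->
      (0 <= 2 `^ p / (1 - 2 `^ (sigma - tau)) * 5 `^ (sigma - tau) :> R)%R.
    move=> st; rewrite mulr_ge0 ?powR_ge0// divr_ge0 ?powR_ge0// subr_ge0.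
    by rewrite ltW// powR2_lt1// subr_lt0.
  by rewrite addr_ge0// geo.
have D0 : 0 <= D.
  rewrite lee_fin -2!mulrA; apply: mulr_ge0 => //.
  by rewrite !mulr_ge0 ?exprn_ge0 ?powR_ge0.
have I1 : \int[mu]_(x in B) `|g x - a|%:E <=
    (oscillation_const / 2 * L ^+ m * A * rho `^ (n%:R + sigma))%:E.
  apply: (@le_trans _ _ (\int[mu]_(x in B) (k * local_potential c rho x + D))).
    apply: ae_ge0_le_integral => //.
    - by move=> x _; rewrite adde_ge0// mule_ge0// local_potential_ge0.
    - apply: emeasurable_funD => //; exact: emeasurable_funM.
  have mkp : measurable_fun B (fun x => k * local_potential c rho x).
    exact: emeasurable_funM.
  have kp0 x : B x -> 0 <= k * local_potential c rho x.
    by move=> _; rewrite mule_ge0// local_potential_ge0.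
  rewrite ge0_integralD//.
  have lp0 x : B x -> 0 <= local_potential c rho x.
    by move=> _; exact: local_potential_ge0.
  rewrite ge0_integralZl// integral_cst//.
  have IL := integral_local_potential rho0 A0 Agrow.
  apply: (le_trans (leeD (lee_wpmul2l k0 IL) (lee_wpmul2l D0 (leb_eball_le c rho0)))).
  rewrite /k /D -!EFinM -EFinD lee_fin.
  have rho1 (t : R) : ((t == 0) ==> (rho != 0))%R by rewrite (gt_eqF rho0) implybT.
  have E1 : (rho `^ (n%:R + sigma) =
      rho `^ (m%:R * delta) * rho `^ p * rho `^ alpha)%R.
    rewrite -(powRD (rho1 _)) -(powRD (rho1 _)).
    by congr (_ `^ _)%R; rewrite /growth_exponent; ring.
  have E2 : (rho `^ (n%:R + sigma) = rho ^+ n * rho `^ sigma)%R.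
    by rewrite (powRD (rho1 _)) powR_mulrn// ltW.
  have -> : (oscillation_const / 2 = 6 `^ (m%:R * delta) * 5 `^ p * CI * 6 `^ alpha
      + far_total * 2 ^+ n)%R.
    by rewrite /oscillation_const mulrAC divff ?mul1r.
  set u := (_ * 6 `^ alpha)%R; set v := (far_total * 2 ^+ n)%R.
  have -> : ((u + v) * L ^+ m * A * rho `^ (n%:R + sigma) =
      u * L ^+ m * A * (rho `^ (m%:R * delta) * rho `^ p * rho `^ alpha) +
      v * L ^+ m * A * (rho ^+ n * rho `^ sigma))%R.
    by rewrite -E1 -E2; ring.
  rewrite /u /v exprMn !powRM ?(ltW rho0)//.
  by rewrite le_eqVlt; apply/orP; left; apply/eqP; ring.
have ig : mu.-integrable B (EFin \o g).
  have iga : mu.-integrable B (EFin \o (fun x => g x - a)%R).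
    apply/integrableP; split; last exact: le_lt_trans I1 (ltry _).
    by apply/measurable_EFinP; apply: measurable_funTS; exact: measurable_funB.
  have := integrableD mB iga (integrable_cst_eball c a rho0).
  by apply: eq_integrable => // x _ /=; rewrite -EFinD subrK.
split=> //; apply: (le_trans (mean_oscillation_le a n_gt0 rho0 ig)).
have two0 : 0 <= 2%:E :> \bar R by rewrite lee_fin.
apply: (le_trans (lee_wpmul2l two0 I1)).
rewrite -EFinM lee_fin le_eqVlt; apply/orP; left; apply/eqP.
by field.
Qed.

Lemma commutator_is_commutator : commutator_converges K b m f ->
  is_commutator K b m f (commutator K b m f).
Proof.
move=> conv; split.
  apply: measurable_Rintegral_parameter; apply: measurable_funM.
    exact: measurable_comm_kernel.
  exact: (measurableT_comp mf measurable_snd).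
apply: filterS (conv) => x ix; apply: filterS (conv) => x' ix'.
have dE : (fun y => (comm_kernel K b m x y - comm_kernel K b m x' y) * f y)%R =
    (fun y => comm_kernel K b m x y * f y - comm_kernel K b m x' y * f y)%R.
  by apply/funext => y; rewrite mulrBl.
split.
  by have H := integrableB measurableT ix ix'; apply: eq_integrable H => // y _ /=; rewrite mulrBl.
by rewrite dE RintegralB.
Qed.

(** Normalizing at a good point [x0] makes the integral of the kernel difference
    converge at almost every point. *)
Lemma commutator_exists : exists g, is_commutator K b m f g.
Proof.
have [x0 _ gx0] := @ae_ball_witness _ 0%R 1%R ltr01 ae_good_point.
pose d x y := ((comm_kernel K b m x y - comm_kernel K b m x0 y) * f y)%R.
exists (fun x => \int[mu]_y d x y)%R; split.
  apply: measurable_Rintegral_parameter; apply: measurable_funM.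
    apply: measurable_funB; first exact: measurable_comm_kernel.
    exact: (measurableT_comp (measurable_comm_kernel1 x0) measurable_snd).
  exact: (measurableT_comp mf measurable_snd).
apply: filterS ae_good_point => x gx; apply: filterS ae_good_point => x' gx'.
split; first exact: good_pair_integrable.
rewrite -RintegralB//; [|exact: good_pair_integrable|exact: good_pair_integrable].
by apply: eq_Rintegral => y _; rewrite /d; ring.
Qed.

End commutator_parts.

(** * Weights and the weighted estimate *)

Section weights.
Local Open Scope ereal_scope.
Context {R : realType} {n : nat}.
Local Notation mu := (leb n : {measure set 'rV[R]_n -> \bar R}).
Variables (r : R) (w : 'rV[R]_n -> R).
Hypotheses (n_gt0 : (0 < n)%N) (r_gt1 : (1 < r)%R).
Hypothesis Aw : A_infty r w.

Local Notation r' := (conj_exponent r).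
Let v (x : 'rV[R]_n) : \bar R := (w x `^ r')%:E^-1.

Lemma conj_exponent_gt0 : (0 < r')%R.
Proof. by rewrite invr_gt0 subr_gt0 invf_lt1// (lt_trans ltr01). Qed.

Lemma conj_exponent_eq1 : (r^-1 + r'^-1 = 1)%R.
Proof. by rewrite invrK addrC subrK. Qed.

Let w0 x : (0 <= w x)%R. Proof. by have [[]] := Aw. Qed.

Let mw : measurable_fun setT w.
Proof. by have [[_ [mw _]] _] := Aw; exact/measurable_EFinP. Qed.

Let v0 x : 0 <= v x. Proof. by have [_ [v0 _ _]] := Aw; exact: v0. Qed.

Let mv D : measurable_fun D v.
Proof. by have [_ [_ [mv' _] _]] := Aw; exact: measurable_funTS mv'. Qed.

Let v_int c (rho : R) : (0 < rho)%R -> mu.-integrable (eball c rho) v.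
Proof. by have [_ [_ [_ iv] _]] := Aw; exact: iv. Qed.

Let vE x : (0 < w x)%R -> v x = ((w x `^ r')^-1)%:E.
Proof. by move=> wx; rewrite /v inver gt_eqF// powR_gt0. Qed.

(** [w^(-r')] is infinite where [w] vanishes, and it is locally integrable. *)
Lemma weight_gt0_ae : {ae mu, forall x, (0 < w x)%R}.
Proof.
have H : {ae mu, forall x, forall N : nat, eball (0 : 'rV[R]_n) N.+1%:R x ->
    v x \is a fin_num}.
  apply: ae_foralln => N; apply: integrable_ae; first exact: measurable_eball.
  by apply: v_int; rewrite ltr0n.
apply: filterS H => x H; rewrite lt_neqAle w0 andbT; apply/eqP => wx0.
have := H (Num.truncn (enorm x)).
rewrite /eball/= subr0 truncnS_gt => /(_ isT).
by rewrite /v -wx0 powR0 ?gt_eqF ?conj_exponent_gt0// inver eqxx.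
Qed.

Let int_v c (rho : R) : R := fine (\int[mu]_(y in eball c rho) v y).

Let int_vE c (rho : R) : (0 < rho)%R ->
  \int[mu]_(y in eball c rho) v y = (int_v c rho)%:E.
Proof.
move=> rho0; rewrite /int_v fineK//.
by apply: integrable_fin_num; [exact: measurable_eball|exact: v_int].
Qed.

Let int_v_gt0 c (rho : R) : (0 < rho)%R -> (0 < int_v c rho)%R.
Proof.
move=> rho0; have mB := measurable_eball c rho.
have I0 : 0 <= \int[mu]_(y in eball c rho) v y by exact: integral_ge0.
rewrite -lte_fin -int_vE// lt_neqAle I0 andbT; apply/eqP => /esym Iv0.
have vz : ae_eq mu (eball c rho) v (cst 0).
  apply: (ae_eq_integral_abs mu mB (@mv _)).1.
  by under eq_integral => y _ do rewrite gee0_abs//.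
have [x xc [wx vx]] := ae_ball_witness n_gt0 c rho0 (filterI weight_gt0_ae vz).
have /= := vx xc; rewrite vE// => -[] /eqP.
by rewrite invr_eq0 gt_eqF// powR_gt0.
Qed.

(** Hoelder's inequality for [f = (f w) w^(-1)]. *)
Lemma integral_le_weighted (f : 'rV[R]_n -> R) c (rho : R) :
  measurable_fun setT f -> (0 < rho)%R ->
  \int[mu]_(y in eball c rho) `|f y|%:E <=
    Lp_weighted_norm r w f * (int_v c rho `^ r'^-1)%:E.
Proof.
move=> mf rho0; have mB := measurable_eball c rho.
pose F y := (f y * w y)%R.
pose G y := (w y `^ (- 1) * \1_(eball c rho) y)%R.
have mF : measurable_fun setT F by exact: measurable_funM.
have mG : measurable_fun setT G.
  apply: measurable_funM; last exact: measurable_indic.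
  exact: (measurableT_comp (measurable_powR _) mw).
have r0 : (0 < r)%R by rewrite (lt_trans ltr01).
have G0 y : (0 <= G y)%R by rewrite mulr_ge0// powR_ge0.
have mfB : measurable_fun setT (fun y => (`|f y| * \1_(eball c rho) y)%:E).
  apply/measurable_EFinP; apply: measurable_funM; last exact: measurable_indic.
  exact: measurableT_comp.
have mFG : measurable_fun setT (fun y => `|(F \* G)%R y|%:E).
  by apply/measurable_EFinP; apply: measurableT_comp => //; exact: measurable_funM.
have -> : \int[mu]_(y in eball c rho) `|f y|%:E = Lnorm mu 1 (EFin \o (F \* G)%R).
  rewrite Lnorm1 integral_eball_indic.
  apply: (ge0_ae_eq_integral measurableT mfB mFG) => //.
  apply: filterS weight_gt0_ae => y wy _ /=.
  rewrite /F /G powR_inv1 ?(ltW wy)// mulrA mulfK ?gt_eqF//.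
  by rewrite normrM (@ger0_norm _ (\1_(eball c rho) y)).
apply: (le_trans (hoelder mu mF mG r0 conj_exponent_gt0 conj_exponent_eq1)).
rewrite lee_wpmul2l ?Lnorm_ge0// unlock -poweR_EFin -int_vE//.
have Gv : \int[mu]_y (`|(EFin \o G) y| `^ r') <= \int[mu]_(y in eball c rho) v y.
  rewrite [leRHS]integral_mkcond; apply: ge0_le_integral => //.
  - by move=> y _; rewrite poweR_ge0.
  - under eq_fun => y do rewrite poweR_EFin.
    apply/measurable_EFinP.
    by apply: (measurableT_comp (measurable_powR _)); exact: measurableT_comp.
  - exact/(measurable_restrictT _ mB).
  move=> y _; rewrite patchE /= ger0_norm// /G indicE; case: ifPn => _; last first.
    by rewrite mulr0 powR0// gt_eqF// conj_exponent_gt0.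
  rewrite mulr1; have [wy|] := ltP 0%R (w y).
    by rewrite vE// lee_fin powRAC powR_inv1 ?powR_ge0.
  move=> wy; have -> : w y = 0%R by apply/eqP; rewrite eq_le wy w0.
  rewrite powR0 ?oppr_eq0 ?oner_eq0//.
  by rewrite powR0 ?gt_eqF ?conj_exponent_gt0.
apply: gt0_ler_poweR => //.
- by rewrite invr_ge0 ltW// conj_exponent_gt0.
- by rewrite in_itv/= leey andbT integral_ge0// => y _; exact: poweR_ge0.
- by rewrite in_itv/= leey andbT integral_ge0.
Qed.

(** The [A_1] condition bounds [w] on a ball by the power [- 1/r'] of the mean of
    [w^(-r')] over any larger concentric ball; in the product with the previous
    bound the integrals of [w^(-r')] cancel. *)
Lemma weighted_growth : exists2 CW : R, (0 < CW)%R &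
  forall f, measurable_fun setT f -> Lp_weighted_norm r w f < +oo ->
  forall c (rho : R), (0 < rho)%R ->
  exists2 N : R, (0 < N)%R &
    Lnorm mu +oo (fun x => (w x * \1_(eball c rho) x)%:E) <= N%:E /\
    forall t : R, (rho <= t)%R ->
      N%:E * \int[mu]_(y in eball c t) `|f y|%:E <=
        Lp_weighted_norm r w f * (CW * t `^ (n%:R - n%:R / r))%:E.
Proof.
have [_ [_ _ [C1 C10 HA1]]] := Aw.
exists ((C1 * 2 ^+ n) `^ r'^-1)%R.
  by rewrite powR_gt0// mulr_gt0// exprn_gt0.
move=> f mf foo c rho rho0.
have mB := measurable_eball c rho.
pose W x := (w x * \1_(eball c rho) x)%:E.
pose Nt (t : R) : R := ((C1 * vol (eball c t) / int_v c t) `^ r'^-1)%R.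
have W0 x : 0 <= W x by rewrite lee_fin mulr_ge0.
have mu0 : 0 < mu setT.
  apply: (@lt_le_trans _ _ (mu (eball c rho))).
    have -> : mu (eball c rho) = (vol (eball c rho))%:E := leb_eballE c rho0.
    by rewrite lte_fin vol_gt0.
  by apply: le_measure; rewrite ?inE.
have Wle t : (rho <= t)%R -> Lnorm mu +oo W <= (Nt t)%:E.
  move=> rt; have t0 : (0 < t)%R by exact: lt_le_trans rt.
  rewrite unlock /Lnorm mu0; apply/ess_supP.
  apply: filterS2 weight_gt0_ae (HA1 c t t0) => x wx H /=.
  rewrite ger0_norm ?mulr_ge0//.
  have [xc|xc] := boolP (x \in eball c rho); last first.
    by rewrite indicE (negbTE xc) mulr0 lee_fin powR_ge0.
  rewrite indicE xc mulr1 lee_fin.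
  have xt : eball c t x.
    by move: xc; rewrite inE /eball/= => xc; exact: lt_le_trans rt.
  have := H xt; rewrite -/v int_vE// -/(v x) vE// -!EFinM lee_fin.
  have V0 := vol_gt0 c n_gt0 t0; have I0 := int_v_gt0 c t0.
  move=> H1.
  have {}H1 : (w x `^ r' <= C1 * vol (eball c t) / int_v c t)%R.
    rewrite ler_pdivlMr//; have Vw : (0 <= vol (eball c t) * w x `^ r')%R.
      by rewrite mulr_ge0 ?powR_ge0// ltW.
    have wr0 : (w x `^ r' != 0)%R by rewrite gt_eqF// powR_gt0.
    have := ler_wpM2l Vw H1; congr (_ <= _)%R; field => //.
      by rewrite gt_eqF.
  have -> : w x = ((w x `^ r') `^ r'^-1)%R.
    by rewrite -powRrM mulfV ?powRr1// gt_eqF// conj_exponent_gt0.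
  apply: ge0_ler_powR => //; rewrite ?nnegrE ?powR_ge0//.
  - by rewrite invr_ge0 ltW// conj_exponent_gt0.
  - by rewrite divr_ge0 ?mulr_ge0 ?ltW.
have N0 : 0 <= Lnorm mu +oo W by exact: Lnorm_ge0.
have Nfin : Lnorm mu +oo W \is a fin_num.
  by rewrite ge0_fin_numE//; exact: le_lt_trans (Wle _ (lexx _)) (ltry _).
exists (fine (Lnorm mu +oo W)).
  rewrite -lte_fin fineK// lt_neqAle N0 andbT; apply/eqP => /esym Nz.
  have Wae : \forall x \ae mu, W x <= 0.
    move: (lexx (Lnorm mu +oo W)); rewrite {2}Nz unlock /Lnorm mu0 => /ess_supP.
    by apply: filterS => x /=; rewrite ger0_norm ?mulr_ge0.
  have [x xc [wx Wx]] := ae_ball_witness n_gt0 c rho0 (filterI weight_gt0_ae Wae).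
  by move: Wx; rewrite /W indicE mem_set// mulr1 lee_fin leNgt wx.
rewrite fineK//; split=> // t rt.
have t0 : (0 < t)%R by exact: lt_le_trans rt.
have I0 := int_v_gt0 c t0.
apply: (le_trans (lee_pmul N0 _ (Wle _ rt) (integral_le_weighted c mf t0))).
  exact: integral_ge0.
rewrite muleCA lee_wpmul2l ?Lnorm_ge0// -EFinM lee_fin.
have V0 := vol_gt0 c n_gt0 t0.
rewrite /Nt -powRM ?divr_ge0 ?mulr_ge0 ?(ltW V0) ?(ltW I0) ?(ltW C10)//.
rewrite divfK ?gt_eqF//.
have -> : (n%:R - n%:R / r = n%:R * r'^-1)%R by rewrite invrK mulrBr mulr1.
rewrite powRrM powR_mulrn ?(ltW t0)// -powRM ?exprn_ge0 ?mulr_ge0 ?exprn_ge0 ?(ltW C10) ?(ltW t0)//.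
apply: ge0_ler_powR; rewrite ?nnegrE.
- by rewrite invr_ge0 ltW// conj_exponent_gt0.
- by rewrite mulr_ge0 ?ltW.
- by rewrite !mulr_ge0 ?exprn_ge0 ?(ltW C10) ?(ltW t0).
- by rewrite -mulrA -exprMn ler_wpM2l ?(ltW C10)// vol_le.
Qed.

End weights.

(** * The weighted Lipschitz estimate *)

(** The bound passes to the infimum of the admissible constants, also when [b] is
    constant and this infimum, [0], is not itself admissible. *)
Lemma Lambda_normP (R : realType) (n : nat) (delta : R) (b : 'rV[R]_n -> R) :
  0 < delta -> Lambda delta b ->
  0 <= Lambda_norm delta b /\
  forall x y, `|b x - b y| <= Lambda_norm delta b * enorm (x - y) `^ delta.
Proof.
move=> delta0 [C bC]; have S0 : [set C | lip_bound delta b C] !=set0 by exists C.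
have nonneg : 0 <= Lambda_norm delta b.
  by apply: lb_le_inf => // D [/ltW].
split=> // x y; have [xy0|] := eqVneq (enorm (x - y)) 0.
  have -> : x = y by apply/eqP; rewrite -subr_eq0; exact/eqP/enorm_eq0.
  by rewrite !subrr normr0 mulr_ge0 ?powR_ge0.
move=> xy; have {}xy : 0 < enorm (x - y) by rewrite lt_neqAle enorm_ge0 andbT eq_sym.
rewrite -ler_pdivrMr ?powR_gt0//; apply: lb_le_inf => // D [_ Dlip].
by rewrite ler_pdivrMr ?powR_gt0.
Qed.

(** The volume of a ball being comparable with [rho^n], the factor
    [rho^(n + sigma)] of the oscillation estimate is comparable with
    [|B|^(1 + sigma / n)]. *)
Lemma weighted_estimate (R : realType) (n m : nat) (alpha eta delta sigma r : R)
    (K w : 'rV[R]_n -> R) :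
  (0 < n)%N -> 0 < alpha -> 0 < eta -> 0 < delta -> m%:R * delta + alpha < n%:R ->
  0 <= sigma -> sigma < delta -> sigma < eta -> 1 < r ->
  sigma = m%:R * delta + alpha - n%:R / r ->
  measurable_fun setT K -> cond_S alpha K -> cond_Hstar_infty alpha eta K ->
  A_infty r w ->
  exists2 C : R, 0 < C & forall (b f : 'rV[R]_n -> R) (L : R), 0 <= L ->
    (forall x y, `|b x - b y| <= L * enorm (x - y) `^ delta) ->
    Lp_weighted r w f ->
    [/\ commutator_converges K b m f -> is_commutator K b m f (commutator K b m f),
        exists g, is_commutator K b m f g
      & forall g, is_commutator K b m f g -> loc_integrable (EFin \o g) /\
        (wlip_norm w sigma g <= (C * L ^+ m)%:E * Lp_weighted_norm r w f)%E].
Proof.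
move=> n0 alpha0 eta0 delta0 order_lt sigma0 sd se r1 sigmaE mK KS KH Aw.
have [CK CK0 Ksize] := kernel_size n0 eta0 mK KS KH alpha0.
have [CI CI0 Kint] := kernel_integral n0 mK KS alpha0.
have [CH CH0 Ksmooth] := KH.
have [CW CW0 HW] := weighted_growth n0 r1 Aw.
pose osc : R := @oscillation_const R n alpha eta delta sigma m CK CH CI.
have nR0 : 0 < n%:R :> R by rewrite ltr0n.
pose e : R := 1 + sigma / n%:R.
pose V0 : R := ((2 / n%:R) ^+ n) `^ e.
have V00 : 0 < V0 by rewrite powR_gt0// exprn_gt0// divr_gt0.
have e0 : 0 <= e by rewrite addr_ge0// divr_ge0// ltW.
exists (`|osc| * CW / V0 + 1).
  by rewrite ltr_wpDl// divr_ge0 ?mulr_ge0 ?(ltW CW0) ?(ltW V00).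
move=> b f L L0 blip [mf foo].
set X := Lp_weighted_norm r w f in foo *.
have X0 : (0 <= X)%E by exact: Lnorm_ge0.
have Xfin : X \is a fin_num by rewrite ge0_fin_numE.
have pE : n%:R - n%:R / r = @growth_exponent R n alpha delta sigma m.
  by rewrite /growth_exponent sigmaE; ring.
have grow c rho : 0 < rho -> exists2 N : R, 0 < N &
    (Lnorm (leb n) +oo (fun x => (w x * \1_(eball c rho) x)%:E) <= N%:E)%E /\
    ball_growth alpha delta sigma f m c rho (fine X * CW / N).
  move=> rho0; have [N N0 [NN HN]] := HW f mf foo c rho rho0.
  exists N => //; split=> // t rt; have := HN t rt.
  rewrite -/X -(fineK Xfin) -EFinM pE => H.
  have Ninv : (0 <= N^-1%:E)%E by rewrite lee_fin invr_ge0 ltW.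
  have := lee_wpmul2l Ninv H.
  rewrite muleA -!EFinM mulVf ?gt_eqF// mul1e => /le_trans; apply.
  by rewrite lee_fin le_eqVlt; apply/orP; left; apply/eqP; ring.
have fgrow c rho : 0 < rho ->
    exists2 A : R, 0 <= A & ball_growth alpha delta sigma f m c rho A.
  move=> rho0; have [N N0 [_ HN]] := grow c rho rho0.
  exists (fine X * CW / N) => //.
  by rewrite divr_ge0 ?mulr_ge0 ?fine_ge0 ?(ltW CW0) ?(ltW N0).
split.
- exact: (commutator_is_commutator delta0 mK mf L0 blip).
- by apply: (@commutator_exists R n alpha eta delta sigma K b f m CK CH CI L).
move=> g Cg; have [mg _] := Cg.
have oscP c rho A : 0 < rho -> 0 <= A -> ball_growth alpha delta sigma f m c rho A ->
    (leb n).-integrable (eball c rho) (EFin \o g) /\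
    (\int[leb n]_(x in eball c rho) `|g x - average g (eball c rho)|%:E <=
      (osc * L ^+ m * A * rho `^ (n%:R + sigma))%:E)%E.
  by move=> *; apply: (@commutator_oscillation R n alpha eta delta sigma K b f m CK CH CI L).
split.
  split; first exact/measurable_EFinP.
  move=> c rho rho0; have [A A0 HA] := fgrow c rho rho0.
  by have [] := oscP c rho A rho0 A0 HA.
apply: ge_ereal_sup => _ [c [rho [rho0 ->]]].
have [N N0 [NN HN]] := grow c rho rho0.
have A0 : 0 <= fine X * CW / N by rewrite divr_ge0 ?mulr_ge0 ?fine_ge0 ?(ltW CW0) ?(ltW N0).
have [_ osc_le] := oscP c rho _ rho0 A0 HN.
have volB0 := vol_gt0 c n0 rho0.
have V1 : V0 * rho `^ (n%:R + sigma) <= vol (eball c rho) `^ e.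
  have -> : V0 * rho `^ (n%:R + sigma) = ((2 * (rho / n%:R)) ^+ n) `^ e.
    have -> : n%:R + sigma = n%:R * e by rewrite /e mulrDr mulr1 mulrCA mulfV ?mulr1 ?gt_eqF.
    rewrite powRrM powR_mulrn ?(ltW rho0)// /V0 -powRM ?exprn_ge0 ?divr_ge0 ?(ltW rho0)//.
    by rewrite -exprMn; congr ((_ ^+ _) `^ _); ring.
  apply: ge0_ler_powR; rewrite ?nnegrE ?(ltW volB0)//.
    by rewrite exprn_ge0// mulr_ge0// divr_ge0// ltW.
  exact: vol_ge.
have Vi0 : 0 <= (vol (eball c rho) `^ e)^-1 by rewrite invr_ge0 powR_ge0.
apply: (@le_trans _ _ ((N * (vol (eball c rho) `^ e)^-1)%:E *
    (osc * L ^+ m * (fine X * CW / N) * rho `^ (n%:R + sigma))%:E)%E).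
  apply: lee_pmul => //.
  - by rewrite mule_ge0 ?Lnorm_ge0.
  - exact: integral_ge0.
  - by rewrite EFinM lee_wpmul2r.
rewrite -[leRHS](fineK _); last by rewrite fin_numM.
rewrite -(fineK Xfin) -!EFinM lee_fin /=.
have Lm0 : 0 <= L ^+ m by rewrite exprn_ge0.
have X0' : 0 <= fine X by rewrite fine_ge0.
apply: (@le_trans _ _ (`|osc| * CW / V0 * L ^+ m * fine X)); last first.
  by rewrite ler_wpM2r// ler_wpM2r// lerDl.
have -> : N / vol (eball c rho) `^ e * (osc * L ^+ m * (fine X * CW / N) * rho `^ (n%:R + sigma))
  = osc * (L ^+ m * fine X * CW * (rho `^ (n%:R + sigma) / vol (eball c rho) `^ e)).
  by field; rewrite gt_eqF ?powR_gt0// gt_eqF.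
have -> : `|osc| * CW / V0 * L ^+ m * fine X = `|osc| * (L ^+ m * fine X * CW * V0^-1).
  by ring.
have volp : 0 < vol (eball c rho) `^ e by rewrite powR_gt0.
apply: (@le_trans _ _ (`|osc| * (L ^+ m * fine X * CW *
    (rho `^ (n%:R + sigma) / vol (eball c rho) `^ e)))).
  apply: ler_wpM2r; last exact: ler_norm.
  by rewrite !mulr_ge0 ?powR_ge0// ltW.
apply: ler_wpM2l => //; apply: ler_wpM2l; first by rewrite !mulr_ge0// ltW.
by rewrite ler_pdivrMr// mulrC ler_pdivlMr// mulrC.
Qed.

Theorem theorem2p3 (R : realType) (n m : nat) (alpha eta delta r : R)
    (K w : 'rV[R]_n -> R) :
  0 < alpha < n%:R ->
  0 < eta <= 1 ->
  measurable_fun setT K ->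
  (exists x, K x != 0) ->
  cond_S alpha K ->
  cond_Hstar_infty alpha eta K ->
  ((0 < m)%N -> 0 < delta < Num.min eta ((n%:R - alpha) / m%:R)) ->
  (if (0 < m)%N
   then n%:R / (m%:R * delta + alpha) <= r
          < n%:R / (alpha + (m%:R - 1) * delta)
   else (n%:R / alpha <= r) &&
        (r%:E < n%:R%:E / (Num.max (alpha - eta) 0)%:E)%E) ->
  A_infty r w ->
  let delta' := m%:R * delta + alpha - n%:R / r in
  exists2 C : R, 0 < C &
    forall b f : 'rV[R]_n -> R,
      ((0 < m)%N -> Lambda delta b) ->
      Lp_weighted r w f ->
      let bounded g := loc_integrable (EFin \o g) /\
        (wlip_norm w delta' g
           <= (C * Lambda_norm delta b ^+ m)%:E * Lp_weighted_norm r w f)%E in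
      [/\ commutator_converges K b m f -> bounded (commutator K b m f),
          exists g, is_commutator K b m f g
        & forall g, is_commutator K b m f g -> bounded g].
Proof.
move=> /andP[alpha0 alphan] /andP[eta0 _] mK _ KS KH deltaH rH Aw delta'.
have n0 : (0 < n)%N by rewrite -(ltr0n R) (lt_trans alpha0).
have nR0 : 0 < n%:R :> R by rewrite ltr0n.
have [m0|m0] := posnP m.
  (* The core estimate is applied with [eta] for [delta] and the zero symbol. *)
  move: deltaH rH; rewrite /delta' {delta'} m0 /= => _ /andP[ra reta].
  have r1 : 1 < r by apply: lt_le_trans ra; rewrite ltr_pdivlMr// mul1r.
  have r0 : 0 < r by rewrite (lt_trans ltr01).
  have sigma0 : 0 <= 0 * delta + alpha - n%:R / r.
    rewrite mul0r add0r subr_ge0 ler_pdivrMr// mulrC.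
    by rewrite -ler_pdivrMr.
  have sigma_eta : 0 * delta + alpha - n%:R / r < eta.
    rewrite mul0r add0r; have [ae|ae] := leP (alpha - eta) 0.
      by have := divr_gt0 nR0 r0; lra.
    move: reta; rewrite (max_idPl (ltW ae)) inver gt_eqF// -EFinM lte_fin.
    by rewrite ltr_pdivlMr// mulrC -ltr_pdivlMr//; lra.
  have [||C C0 HC] := @weighted_estimate R n 0 alpha eta eta
    (0 * delta + alpha - n%:R / r) r K w n0 alpha0 eta0 eta0 _ sigma0 sigma_eta sigma_eta r1 _
    mK KS KH Aw.
  - by rewrite mul0r add0r.
  - by rewrite !mul0r.
  exists C => // b f _ Lf.
  pose bounded g := loc_integrable (EFin \o g) /\
    (wlip_norm w (0 * delta + alpha - n%:R / r) g
      <= (C * Lambda_norm delta b ^+ 0)%:E * Lp_weighted_norm r w f)%E.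
  have lip0 (x y : 'rV[R]_n) : `|cst (0 : R) x - cst 0 y| <= 1 * enorm (x - y) `^ eta.
    by rewrite subrr normr0 mul1r powR_ge0.
  have [H1 H2 H3] := HC (cst 0) f 1 ler01 lip0 Lf.
  have KE : comm_kernel K b 0 = comm_kernel K (cst 0) 0.
    by apply/funext => x; apply/funext => y; rewrite /comm_kernel !expr0.
  have E : is_commutator K b 0 f = is_commutator K (cst 0) 0 f.
    by rewrite /is_commutator KE.
  have bE g : is_commutator K b 0 f g -> bounded g.
    by rewrite E => /H3; rewrite /bounded !expr0.
  split; last exact: bE.
    move=> conv; apply: bE.
    have -> : commutator K b 0 f = commutator K (cst 0) 0 f by rewrite /commutator KE.
    by rewrite E; apply: H1; move: conv; rewrite /commutator_converges KE.
  by have [g Cg] := H2; exists g; rewrite E.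
have m1 : 0 < m%:R :> R by rewrite ltr0n.
move: (deltaH m0) rH; rewrite m0 lt_min => /andP[delta0 /andP[delta_eta delta_n]].
rewrite ltr_pdivlMr// in delta_n.
have md0 : 0 < m%:R * delta by rewrite mulr_gt0.
have order_lt : m%:R * delta + alpha < n%:R by lra.
have m1_ge0 : 0 <= (m%:R - 1) * delta.
  by rewrite mulr_ge0 ?(ltW delta0)// subr_ge0 ler1n.
have ord0 : 0 < m%:R * delta + alpha by lra.
have ord1 : 0 < alpha + (m%:R - 1) * delta by lra.
move=> /andP[rlo rhi].
have r1 : 1 < r by apply: lt_le_trans rlo; rewrite ltr_pdivlMr// mul1r.
have r0 : 0 < r by rewrite (lt_trans ltr01).
(* The lower bound on [r] means [0 <= delta'], the upper one [delta' < delta]. *)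
have sigma0 : 0 <= delta'.
  rewrite subr_ge0 ler_pdivrMr// mulrC.
  by rewrite -ler_pdivrMr.
have sigma_delta : delta' < delta.
  rewrite ltr_pdivlMr// mulrC -ltr_pdivlMr// in rhi.
  rewrite /delta'; move: rhi; rewrite mulrBl mul1r; lra.
have sigma_eta : delta' < eta by apply: lt_trans delta_eta.
have [C C0 HC] := weighted_estimate n0 alpha0 eta0 delta0 order_lt sigma0
  sigma_delta sigma_eta r1 erefl mK KS KH Aw.
exists C => // b f bL Lf bounded.
have [L0 blip] := Lambda_normP delta0 (bL isT).
have [H1 H2 H3] := HC b f _ L0 blip Lf.
by split=> // conv; apply: H3; exact: H1.
Qed.
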